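(* Let $R$ be a semiprimary ring. The following conditions are equivalent: (i) The category of right $R$-modules of finite length has CSL. (ii) The right Gabriel quiver of $R$ is totally disconnected. (iii) $R$ is (isomorphic to) a finite direct product of full matrix rings over local rings. (iv) The category of all right $R$-modules has CSL.
   Context: Rings are associative with identity (not necessarily commutative) and modules are unital. A ring $R$ is semiprimary if its Jacobson radical $\operatorname{rad}(R)$ is nilpotent and $R/\operatorname{rad}(R)$ is a semisimple ring. A (not necessarily commutative) ring $L$ is local if $L/\operatorname{rad}(L)$ is a division ring. A category $\mathcal{C}$ of right $R$-modules (a full subcategory of the category of all right $R$-modules) ''has CSL'' (converse of Schur's Lemma) if every object $M$ of $\mathcal{C}$ whose endomorphism ring $\operatorname{End}(M_R)$ is a division ring is a simple module. The right Gabriel quiver (right Ext-quiver) of $R$ is the directed graph whose points are in bijective correspondence with the isomorphism classes of simple right $R$-modules, with an arrow $i \to j$ whenever the corresponding simple modules $S_i$ and $S_j$ satisfy $\operatorname{Ext}^1_R(S_i,S_j)\neq\{0\}$. It is called totally disconnected if there are no arrows between any two different points (loops are allowed); that is, $\operatorname{Ext}^1_R(S,T)=\{0\}$ for all nonisomorphic simple right $R$-modules $S$ and $T$. *)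

(* Defs.v *)
From HB Require Import structures.
From mathcomp Require Import all_boot all_order all_algebra.
From mathcomp Require Import boolp classical_sets.

Set Implicit Arguments.
Unset Strict Implicit.
Unset Printing Implicit Defensive.

Import GRing.Theory.
Local Open Scope ring_scope.
Local Open Scope classical_set_scope.

(* Rings are pzRingType (associative, unital, not assumed commutative; the    *)
(* zero ring is allowed). A right R-module is a left module over the converse *)
(* ring R^c: for M : rmodType R, "a *: v" is the right action v a. Notions    *)
(* about modules are stated for left modules over an arbitrary ring A and     *)
(* are used with A := R^c.                                                    *)
Notation rmodType R := (lmodType R^c).

Section Submodules.
Variables (A : pzRingType) (M : lmodType A).

Definition is_submod (N : set M) : Prop :=
  [/\ N 0, (forall u v, N u -> N v -> N (u + v))
      & (forall (a : A) u, N u -> N (a *: u))].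

Definition simple_mod : Prop :=
  (exists v : M, v <> 0) /\
  (forall N : set M, is_submod N -> N = [set 0] \/ N = setT).

Definition maximal_submod (N : set M) : Prop :=
  [/\ is_submod N, N <> setT
    & forall K : set M, is_submod K -> N `<=` K -> K = N \/ K = setT].

Definition semisimple_mod : Prop :=
  forall N : set M, is_submod N ->
  exists K : set M, [/\ is_submod K, N `&` K = [set 0]
                      & forall v, exists x y, [/\ N x, K y & v = x + y]].

(* A composition series 0 = N_0 < N_1 < ... < N_n = M; simplicity of          *)
(* N_{i+1}/N_i is expressed by the absence of submodules strictly in between. *)
Definition finite_length : Prop :=
  exists (n : nat) (N : nat -> set M),
  [/\ N 0 = [set 0], N n = setT, (forall i, (i <= n)%N -> is_submod (N i))
    & forall i, (i < n)%N ->
      [/\ N i `<=` N i.+1, N i <> N i.+1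
        & forall K : set M, is_submod K -> N i `<=` K -> K `<=` N i.+1 ->
          K = N i \/ K = N i.+1]].

End Submodules.

Arguments simple_mod {A} M.
Arguments semisimple_mod {A} M.
Arguments finite_length {A} M.

Definition isomorphic_mod (A : pzRingType) (M N : lmodType A) : Prop :=
  exists f : {linear M -> N}, bijective f.

Definition isomorphic_ring (A B : pzRingType) : Prop :=
  exists f : {rmorphism A -> B}, bijective f.

Definition division_ring (A : pzRingType) : Prop :=
  (1 : A) <> 0 /\ forall x : A, x <> 0 -> exists y, y * x = 1 /\ x * y = 1.

(* The endomorphism ring of M, with (f * g) v = f (g v): endomorphisms of the  *)
(* right module M act on the left.                                            *)
Section Endomorphisms.
Variables (A : pzRingType) (M : lmodType A).

Definition endo : Type := {linear M -> M}.

Definition endo_fun (f : endo) : M -> M := (f : {linear M -> M}).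

HB.instance Definition _ := gen_eqMixin endo.
HB.instance Definition _ := gen_choiceMixin endo.

Lemma endoP (f g : endo) : endo_fun f =1 endo_fun g -> f = g.
Proof.
rewrite /endo_fun => /funext.
case: f => f [[cf1] [cf2]]; case: g => g [[cg1] [cg2]] /= fg.
case: _ / fg in cg1 cg2 *.
by rewrite (Prop_irrelevance cf1 cg1) (Prop_irrelevance cf2 cg2).
Qed.

Definition endo_add (f g : endo) : endo :=
  ((f : {linear M -> M}) \+ (g : {linear M -> M})) : {linear M -> M}.
Definition endo_opp (f : endo) : endo :=
  (\- (f : {linear M -> M})) : {linear M -> M}.
Definition endo_zero : endo := (\0 : M -> M) : {linear M -> M}.
Definition endo_mul (f g : endo) : endo :=
  ((f : {linear M -> M}) \o (g : {linear M -> M})) : {linear M -> M}.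
Definition endo_one : endo := (idfun : M -> M) : {linear M -> M}.

Fact endo_addA : associative endo_add.
Proof. by move=> f g h; apply: endoP => v; apply: addrA. Qed.
Fact endo_addC : commutative endo_add.
Proof. by move=> f g; apply: endoP => v; apply: addrC. Qed.
Fact endo_add0 : left_id endo_zero endo_add.
Proof. by move=> f; apply: endoP => v; apply: add0r. Qed.
Fact endo_addN : left_inverse endo_zero endo_opp endo_add.
Proof. by move=> f; apply: endoP => v; apply: addNr. Qed.

HB.instance Definition _ :=
  GRing.isZmodule.Build endo endo_addA endo_addC endo_add0 endo_addN.

Fact endo_mulA : associative endo_mul.
Proof. by move=> f g h; apply: endoP. Qed.
Fact endo_mul1l : left_id endo_one endo_mul.
Proof. by move=> f; apply: endoP. Qed.
Fact endo_mul1r : right_id endo_one endo_mul.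
Proof. by move=> f; apply: endoP. Qed.
Fact endo_mulDl : left_distributive endo_mul endo_add.
Proof. by move=> f g h; apply: endoP. Qed.
Fact endo_mulDr : right_distributive endo_mul endo_add.
Proof.
by move=> f g h; apply: endoP => v; apply: (raddfD (f : {linear M -> M})).
Qed.

HB.instance Definition _ := GRing.Zmodule_isPzRing.Build endo
  endo_mulA endo_mul1l endo_mul1r endo_mulDl endo_mulDr.
End Endomorphisms.

(* A category of A-modules, i.e. a full subcategory, is given by its class C  *)
(* of objects.                                                                *)
Definition has_CSL (A : pzRingType) (C : lmodType A -> Prop) : Prop :=
  forall M : lmodType A, C M -> division_ring (endo M) -> simple_mod M.

(* Ext^1(S, T) in the sense of Yoneda: classes of extensions                  *)
(* 0 -> T -> E -> S -> 0, with zero element the class of T x S. A morphism of *)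
(* extensions is automatically bijective.                                     *)
Section Extensions.
Variables (A : pzRingType) (S T : lmodType A).

Record extension := Extension {
  ext_mod :> lmodType A;
  ext_in : {linear T -> ext_mod};
  ext_out : {linear ext_mod -> S};
  ext_in_inj : injective ext_in;
  ext_out_surj : forall s : S, exists e : ext_mod, ext_out e = s;
  ext_exact : forall e : ext_mod, ext_out e = 0 <-> exists t : T, ext_in t = e
}.

Definition ext_equiv (E F : extension) : Prop :=
  exists h : {linear E -> F},
    h \o ext_in E =1 ext_in F /\ ext_out F \o h =1 ext_out E.

Definition split_in (t : T) : (T * S)%type := (t, 0).
Definition split_out (e : (T * S)%type) : S := e.2.

Fact split_in_linear : linear split_in.
Proof. by move=> a t u; congr pair; rewrite /= scaler0 addr0. Qed.
HB.instance Definition _ :=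
  GRing.isLinear.Build A T (T * S)%type *:%R split_in split_in_linear.

Fact split_out_linear : linear split_out.
Proof. by []. Qed.
HB.instance Definition _ :=
  GRing.isLinear.Build A (T * S)%type S *:%R split_out split_out_linear.

Fact split_in_inj : injective split_in.
Proof. by move=> t u []. Qed.
Fact split_out_surj (s : S) : exists e, split_out e = s.
Proof. by exists (0, s). Qed.
Fact split_exact e : split_out e = 0 <-> exists t, split_in t = e.
Proof.
by split=> [|[t <-]//]; case: e => t s /= ->; exists t.
Qed.

Definition split_ext : extension :=
  @Extension (T * S)%type split_in split_out
    split_in_inj split_out_surj split_exact.

Definition Ext1_eq0 : Prop := forall E : extension, ext_equiv E split_ext.

End Extensions.

(* The points of the right Gabriel quiver of R are the simple right R-modules *)
(* up to isomorphism.                                                         *)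
Definition gabriel_arrow (R : pzRingType) (S T : rmodType R) : Prop :=
  ~ Ext1_eq0 S T.

Definition gabriel_totally_disconnected (R : pzRingType) : Prop :=
  forall S T : rmodType R, simple_mod S -> simple_mod T ->
    ~ isomorphic_mod S T -> ~ gabriel_arrow S T.

(* Two-sided ideals and quotient rings; ring_quotient only covers commutative *)
(* rings and decidable ideals.                                                *)
Record ideal (R : pzRingType) := Ideal {
  ideal_set :> R -> Prop;
  ideal0 : ideal_set 0;
  idealB : forall x y, ideal_set x -> ideal_set y -> ideal_set (x - y);
  idealMl : forall a x, ideal_set x -> ideal_set (a * x);
  idealMr : forall a x, ideal_set x -> ideal_set (x * a)
}.

Definition nilpotent_ideal (R : pzRingType) (I : ideal R) : Prop :=
  exists n : nat, forall x : 'I_n -> R,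
    (forall i, I (x i)) -> \prod_(i < n) x i = 0.

Section QuotientRing.
Local Open Scope quotient_scope.
Variables (R : pzRingType) (I : ideal R).

Definition ideal_rel : rel R := fun x y => `[< I (x - y) >].

Fact idealN x : I x -> I (- x).
Proof. by move=> Ix; rewrite -sub0r; apply: idealB => //; apply: ideal0. Qed.
Fact idealD x y : I x -> I y -> I (x + y).
Proof. by move=> Ix Iy; rewrite -[y]opprK; apply/idealB/idealN. Qed.

Fact ideal_rel_refl : reflexive ideal_rel.
Proof. by move=> x; apply/asboolP; rewrite subrr; apply: ideal0. Qed.
Fact ideal_rel_sym : symmetric ideal_rel.
Proof.
by move=> x y; apply/asboolP/asboolP => /idealN; rewrite opprB.
Qed.
Fact ideal_rel_trans : transitive ideal_rel.
Proof.
move=> y x z /asboolP xy /asboolP yz; apply/asboolP.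
by rewrite -(subrKA y); apply: idealD.
Qed.

Canonical ideal_equiv :=
  EquivRel ideal_rel ideal_rel_refl ideal_rel_sym ideal_rel_trans.

Definition quotient_ring : Type := {eq_quot ideal_equiv}.
HB.instance Definition _ := Choice.on quotient_ring.

Definition quo (x : R) : quotient_ring := \pi_{eq_quot ideal_equiv} x.
Definition quo_repr (q : quotient_ring) : R :=
  repr (q : {eq_quot ideal_equiv}).

Lemma quo_reprK q : quo (quo_repr q) = q.
Proof. exact: reprK. Qed.

Lemma quoP (x y : R) : quo x = quo y <-> I (x - y).
Proof.
by split=> [/eqmodP/asboolP//|Ixy]; apply/eqmodP/asboolP.
Qed.

Definition quo_add (p q : quotient_ring) := quo (quo_repr p + quo_repr q).
Definition quo_opp (p : quotient_ring) := quo (- quo_repr p).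
Definition quo_mul (p q : quotient_ring) := quo (quo_repr p * quo_repr q).

Lemma quoE x : exists2 a, I a & quo_repr (quo x) = x + a.
Proof.
exists (quo_repr (quo x) - x); last by rewrite addrC subrK.
by apply/quoP; rewrite quo_reprK.
Qed.

Lemma quo_addE x y : quo_add (quo x) (quo y) = quo (x + y).
Proof.
have [a Ia Ea] := quoE x; have [b Ib Eb] := quoE y.
apply/quoP; rewrite Ea Eb addrACA (addrAC (x + y)) subrr add0r.
exact: idealD.
Qed.

Lemma quo_oppE x : quo_opp (quo x) = quo (- x).
Proof.
have [a Ia Ea] := quoE x.
by apply/quoP; rewrite Ea opprD (addrAC (- x)) subrr add0r; apply: idealN.
Qed.

Lemma quo_mulE x y : quo_mul (quo x) (quo y) = quo (x * y).
Proof.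
have [a Ia Ea] := quoE x; have [b Ib Eb] := quoE y.
apply/quoP; rewrite Ea Eb mulrDl mulrDr -(addrA (x * y)) (addrAC (x * y)) subrr add0r.
by apply: idealD; [apply: idealMl | apply: idealMr].
Qed.

Lemma quo_ind (P : quotient_ring -> Prop) :
  (forall x, P (quo x)) -> forall q, P q.
Proof. by move=> Pq q; rewrite -(quo_reprK q). Qed.

Fact quo_addA : associative quo_add.
Proof.
by elim/quo_ind=> x; elim/quo_ind=> y; elim/quo_ind=> z; rewrite !quo_addE addrA.
Qed.
Fact quo_addC : commutative quo_add.
Proof. by elim/quo_ind=> x; elim/quo_ind=> y; rewrite !quo_addE addrC. Qed.
Fact quo_add0 : left_id (quo 0) quo_add.
Proof. by elim/quo_ind=> x; rewrite quo_addE add0r. Qed.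
Fact quo_addN : left_inverse (quo 0) quo_opp quo_add.
Proof. by elim/quo_ind=> x; rewrite quo_oppE quo_addE addNr. Qed.

HB.instance Definition _ :=
  GRing.isZmodule.Build quotient_ring quo_addA quo_addC quo_add0 quo_addN.

Fact quo_mulA : associative quo_mul.
Proof.
by elim/quo_ind=> x; elim/quo_ind=> y; elim/quo_ind=> z; rewrite !quo_mulE mulrA.
Qed.
Fact quo_mul1l : left_id (quo 1) quo_mul.
Proof. by elim/quo_ind=> x; rewrite quo_mulE mul1r. Qed.
Fact quo_mul1r : right_id (quo 1) quo_mul.
Proof. by elim/quo_ind=> x; rewrite quo_mulE mulr1. Qed.
Fact quo_mulDl : left_distributive quo_mul quo_add.
Proof.
elim/quo_ind=> x; elim/quo_ind=> y; elim/quo_ind=> z.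
by rewrite !(quo_mulE, quo_addE) mulrDl.
Qed.
Fact quo_mulDr : right_distributive quo_mul quo_add.
Proof.
elim/quo_ind=> x; elim/quo_ind=> y; elim/quo_ind=> z.
by rewrite !(quo_mulE, quo_addE) mulrDr.
Qed.

HB.instance Definition _ := GRing.Zmodule_isPzRing.Build quotient_ring
  quo_mulA quo_mul1l quo_mul1r quo_mulDl quo_mulDr.
End QuotientRing.

(* The regular right R-module R_R; its submodules are the right ideals of R.  *)
Definition regular_rmod (R : pzRingType) : rmodType R := (R^c)^o.

Section JacobsonRadical.
Variable R : pzRingType.

Definition rad_set : set R :=
  [set x : R | forall N : set (regular_rmod R), maximal_submod N -> N x].

Fact rad_set0 : rad_set 0.
Proof. by move=> N [[]]. Qed.
Fact rad_setB x y : rad_set x -> rad_set y -> rad_set (x - y).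
Proof.
move=> Rx Ry N Nmax; have [[_ ND NZ] _ _] := Nmax.
apply: (ND x (- y)); first exact: Rx.
by have := NZ (-1) y (Ry _ Nmax); rewrite scaleN1r.
Qed.
Fact rad_setMr a x : rad_set x -> rad_set (x * a).
Proof.
by move=> Rx N Nmax; have [[_ _ NZ] _ _] := Nmax; exact: (NZ a x (Rx N Nmax)).
Qed.
Fact rad_setMl a x : rad_set x -> rad_set (a * x).
Proof.
move=> Rx N [[N0 ND NZ] NT Nmax].
pose K : set (regular_rmod R) := [set y : R | N (a * y)].
have K_submod : is_submod K.
  split=> [|u v Ku Kv|b u Ku]; rewrite /K /=.
  - by rewrite mulr0.
  - by rewrite mulrDr; apply: ND.
  - by rewrite mulrA; apply: (NZ b).
have [KT|KT] := pselect (K = setT); first by rewrite -[N _]/(K x) KT.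
apply: (Rx K); split=> // K' K'_submod KK'; have [K'0 K'D K'Z] := K'_submod.
pose N' : set (regular_rmod R) :=
  [set z : R | exists n y : R, [/\ N n, K' y & z = n + a * y]].
have N'_submod : is_submod N'.
  split=> [|u v [n [y [Nn Ky ->]]] [m [z [Nm Kz ->]]]|b u [n [y [Nn Ky ->]]]].
  - by exists 0, 0; split=> //; rewrite mulr0 addr0.
  - exists (n + m), (y + z); split; [exact: ND | exact: K'D |].
    by rewrite mulrDr addrACA.
  - exists (n * b), (y * b); split; [exact: (NZ b) | exact: (K'Z b) |].
    by rewrite -[LHS]/((n + a * y) * b) mulrDl mulrA.
have NN' : N `<=` N'.
  by move=> z Nz; exists z, 0; split=> //; rewrite mulr0 addr0.
have [N'N|N'T] := Nmax N' N'_submod NN'.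
  left; apply/seteqP; split=> // y K'y; rewrite /K /= -N'N.
  by exists 0, y; split=> //; rewrite add0r.
right; apply/seteqP; split=> // z _.
have [n [y [Nn K'y az]]] : N' (a * z) by rewrite N'T.
rewrite -(subrK y z); apply: K'D => //; apply: KK'.
by rewrite /K /= mulrBr az addrK.
Qed.

Definition rad : ideal R := Ideal rad_set0 rad_setB rad_setMl rad_setMr.
End JacobsonRadical.

Definition semisimple_ring (R : pzRingType) : Prop :=
  semisimple_mod (regular_rmod R).

Definition semiprimary (R : pzRingType) : Prop :=
  nilpotent_ideal (rad R) /\ semisimple_ring (quotient_ring (rad R)).

Definition local_ring (L : pzRingType) : Prop :=
  division_ring (quotient_ring (rad L)).

(* The direct product of a finite family of rings.                            *)
Section ProductRing.
Variables (I : finType) (B : I -> pzRingType).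

Definition prod_ring : Type := {dffun forall i : I, B i}.
HB.instance Definition _ := Choice.on prod_ring.
Implicit Types f g h : prod_ring.

Definition prod_add f g : prod_ring := [ffun i => f i + g i].
Definition prod_opp f : prod_ring := [ffun i => - f i].
Definition prod_zero : prod_ring := [ffun i => 0].
Definition prod_mul f g : prod_ring := [ffun i => f i * g i].
Definition prod_one : prod_ring := [ffun i => 1].

Fact prod_addA : associative prod_add.
Proof. by move=> f g h; apply/ffunP => i; rewrite !ffunE addrA. Qed.
Fact prod_addC : commutative prod_add.
Proof. by move=> f g; apply/ffunP => i; rewrite !ffunE addrC. Qed.
Fact prod_add0 : left_id prod_zero prod_add.
Proof. by move=> f; apply/ffunP => i; rewrite !ffunE add0r. Qed.
Fact prod_addN : left_inverse prod_zero prod_opp prod_add.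
Proof. by move=> f; apply/ffunP => i; rewrite !ffunE addNr. Qed.

HB.instance Definition _ :=
  GRing.isZmodule.Build prod_ring prod_addA prod_addC prod_add0 prod_addN.

Fact prod_mulA : associative prod_mul.
Proof. by move=> f g h; apply/ffunP => i; rewrite !ffunE mulrA. Qed.
Fact prod_mul1l : left_id prod_one prod_mul.
Proof. by move=> f; apply/ffunP => i; rewrite !ffunE mul1r. Qed.
Fact prod_mul1r : right_id prod_one prod_mul.
Proof. by move=> f; apply/ffunP => i; rewrite !ffunE mulr1. Qed.
Fact prod_mulDl : left_distributive prod_mul prod_add.
Proof. by move=> f g h; apply/ffunP => i; rewrite !ffunE mulrDl. Qed.
Fact prod_mulDr : right_distributive prod_mul prod_add.
Proof. by move=> f g h; apply/ffunP => i; rewrite !ffunE mulrDr. Qed.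

HB.instance Definition _ := GRing.Zmodule_isPzRing.Build prod_ring
  prod_mulA prod_mul1l prod_mul1r prod_mulDl prod_mulDr.
End ProductRing.

Definition product_of_matrix_rings_over_local_rings (R : pzRingType) : Prop :=
  exists (k : nat) (n : 'I_k -> nat) (L : 'I_k -> pzRingType),
  [/\ (forall i, (0 < n i)%N), (forall i, local_ring (L i))
    & isomorphic_ring R (prod_ring (fun i => 'M[L i]_(n i) : pzRingType))].

(* Main.v *)
(** (i) => (ii): if S and T are simple and not isomorphic, a nonsplit extension
    E of S by T has no submodules but 0, T and E, so a nonzero endomorphism of E
    is bijective; E has length 2 and is not simple.

    (ii) => (iii): let J = rad R and write 1 as a sum of orthogonal idempotents
    e_i with every e_i R / e_i J simple. If e_i R and e_j R are not isomorphic,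
    the vanishing of Ext^1(e_i R / e_i J, e_j R / e_j J) gives
    e_i J e_j <= e_i J^2 e_j. Inserting 1 = sum_l e_l between two factors of J
    improves e_i J e_j <= J^k to e_i J e_j <= J^(k+1), because l is not
    equivalent to both i and j. Hence e_i R e_j = 0 by nilpotency, and R is the
    product, over the isomorphism classes of the e_i R, of matrix rings over the
    local rings e_i R e_i.

    (iii) => (iv): let End M be a division ring. The central idempotents of the
    product act on M as 0 or 1, so M is a module over one block, which has a
    single simple module. By nilpotency of J, M has a simple quotient and a
    simple submodule; these being isomorphic, the composite of M onto the first
    with the inclusion of the second is a nonzero endomorphism, hence
    surjective, and M is simple. *)

From Pilot Require Import Defs.
From HB Require Import structures.
From mathcomp Require Import all_boot all_order all_algebra.
From mathcomp Require Import boolp classical_sets.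

Set Implicit Arguments.
Unset Strict Implicit.
Unset Printing Implicit Defensive.

(* Pilot.Defs comes last: GRing.Theory also exports an idealMr. *)
Import GRing.Theory Pilot.Defs.
Local Open Scope ring_scope.
Local Open Scope classical_set_scope.

(** * Linear maps given by graphs; submodules *)

Lemma inj_surj_bijective (T U : Type) (f : T -> U) :
  injective f -> (forall u, exists t, f t = u) -> bijective f.
Proof.
move=> fI fS; have [g gK] := choice fS.
by exists g => // t; apply: fI; rewrite gK.
Qed.

(** A linear relation that relates 0 to 0 only is single-valued: subtract two of its pairs. This
    serves to define maps out of quotients by values on representatives. *)
Lemma linear_of_graph (A : pzRingType) (U V : lmodType A) (G : U -> V -> Prop) :
    (forall u, exists v, G u v) -> (forall v, G 0 v -> v = 0) ->
    (forall a u u' v v', G u v -> G u' v' -> G (a *: u + u') (a *: v + v')) ->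
  exists f : {linear U -> V}, forall u v, G u v -> f u = v.
Proof.
move=> Gtot G0 Glin; have [g gG] := choice Gtot.
have Guniq u v v' : G u v -> G u v' -> v = v'.
  move=> Gv Gv'; have := Glin (-1) _ _ _ _ Gv Gv'.
  by rewrite !scaleN1r addNr => /G0/eqP; rewrite addrC subr_eq0 => /eqP.
have g_lin : linear g by move=> a u v; apply: (Guniq _ _ _ (gG _)); apply: Glin.
pose gL : {linear U -> V} := HB.pack g (GRing.isLinear.Build A U V *:%R g g_lin).
by exists gL => u v /(Guniq _ _ _ (gG u)).
Qed.

Section Submodules.
Variables (A : pzRingType) (M : lmodType A).

Lemma submod0 : is_submod [set (0 : M)].
Proof.
by split=> // [u v -> ->|a u ->]; rewrite /= ?addr0 ?scaler0.
Qed.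

Lemma submodT : is_submod [set: M].
Proof. by []. Qed.

Lemma submodN (N : set M) u : is_submod N -> N u -> N (- u).
Proof. by case=> _ _ NZ Nu; rewrite -scaleN1r; apply: NZ. Qed.

Lemma submodB (N : set M) u v : is_submod N -> N u -> N v -> N (u - v).
Proof. by move=> sN Nu Nv; have [_ ND _] := sN; apply: ND => //; apply: submodN. Qed.

Lemma submod_sum (N : set M) (I : Type) (r : seq I) (P : pred I) (F : I -> M) :
  is_submod N -> (forall i, P i -> N (F i)) -> N (\sum_(i <- r | P i) F i).
Proof. by case=> N0 ND _ NF; elim/big_ind: _. Qed.

Lemma submodI (N K : set M) : is_submod N -> is_submod K -> is_submod (N `&` K).
Proof.
move=> [N0 ND NZ] [K0 KD KZ]; split=> //.
- by move=> u v [Nu Ku] [Nv Kv]; split; [apply: ND | apply: KD].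
- by move=> a u [Nu Ku]; split; [apply: NZ | apply: KZ].
Qed.

Lemma submod_preimage (M' : lmodType A) (f : {linear M -> M'}) (N : set M') :
  is_submod N -> is_submod (f @^-1` N).
Proof.
move=> [N0 ND NZ]; split=> [|u v Nu Nv|a u Nu]; rewrite /preimage /=.
- by rewrite linear0.
- by rewrite linearD; apply: ND.
- by rewrite linearZ; apply: NZ.
Qed.

Lemma submod_image (M' : lmodType A) (f : {linear M -> M'}) (N : set M) :
  is_submod N -> is_submod (f @` N).
Proof.
move=> [N0 ND NZ]; split=> [|_ _ [u Nu <-] [v Nv <-]|a _ [u Nu <-]].
- by exists 0; [|exact: linear0].
- by exists (u + v); [exact: ND | exact: linearD].
- by exists (a *: u); [exact: NZ | exact: linearZ].
Qed.

End Submodules.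

(** * Nonsplit extensions of simple modules *)

Section NonsplitExtensions.
Variables (A : pzRingType) (S T : lmodType A) (E : extension S T).
Hypotheses (Ssimple : simple_mod S) (Tsimple : simple_mod T).
Hypothesis Ensplit : ~ ext_equiv E (split_ext S T).

Let T' : set E := range (ext_in E).

Lemma ext_in_submod : is_submod T'.
Proof. exact/submod_image/submodT. Qed.

Lemma ext_in_proper : T' <> [set 0] /\ T' <> setT.
Proof.
have [[[s s0] _] [[t t0] _]] := (Ssimple, Tsimple); split=> eqT'.
  have : T' (ext_in E t) by exists t.
  by rewrite eqT' /= -(linear0 (ext_in E)) => /ext_in_inj.
have [e es] := @ext_out_surj _ _ _ E s; have : T' e by rewrite eqT'.
by case=> t' _ tE; apply: s0; rewrite -es; apply/ext_exact; exists t'.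
Qed.

(** The image of [N] in [S] and its trace on [T] are each zero or everything. Image [S] with trace 0
    would make [N] a complement of [T'] and split [E]; every other combination determines [N]. *)
Lemma nonsplit_submod (N : set E) :
  is_submod N -> [\/ N = [set 0], N = T' | N = setT].
Proof.
move=> sN; have [N0 ND NZ] := sN.
have outN : ext_out E @` N = [set 0] \/ ext_out E @` N = setT.
  by apply: (proj2 Ssimple); apply: submod_image.
have inN : ext_in E @^-1` N = [set 0] \/ ext_in E @^-1` N = setT.
  by apply: (proj2 Tsimple); apply: submod_preimage.
have NT' : ext_out E @` N = [set 0] -> N `<=` T'.
  move=> oN0 e Ne; have : (ext_out E @` N) (ext_out E e) by exists e.
  by rewrite oN0 /= => /ext_exact[t te]; exists t.
have T'N : ext_in E @^-1` N = setT -> T' `<=` N.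
  by move=> iNT _ [t _ <-]; have : (ext_in E @^-1` N) t by rewrite iNT.
case: inN => inN; case: outN => outN.
- constructor 1; apply/seteqP; split=> [e Ne|_ -> //].
  have [t _ te] := NT' outN e Ne; have : (ext_in E @^-1` N) t by rewrite /= te.
  by rewrite inN /= => t0; rewrite -te t0 linear0.
- case: Ensplit.
  (* Graph of the splitting: the first component is the projection of [E] onto [T] along [N]. *)
  pose G (e : E) (p : (T * S)%type) := N (e - ext_in E p.1) /\ p.2 = ext_out E e.
  have Gtot e : exists p, G e p.
    have : (ext_out E @` N) (ext_out E e) by rewrite outN.
    case=> n Nn ne; have /ext_exact[t tE] : ext_out E (e - n) = 0.
      by rewrite linearB ne subrr.
    by exists (t, ext_out E e); rewrite /G /= tE opprB addrC subrK.
  have [//|[t s]||h hG] := @linear_of_graph A E (T * S)%type G.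
  + rewrite /G /= sub0r linear0 => -[/(submodN sN)]; rewrite opprK => Nt ->.
    by have : (ext_in E @^-1` N) t by []; rewrite inN /= => ->.
  + move=> a u u' [t s] [t' s'] [/= Nt ->] [/= Nt' ->]; split; last first.
      by rewrite linearP.
    rewrite -[(_ + _).1]/(a *: t + t') linearP opprD addrACA -scalerBr.
    by apply: ND => //; apply: NZ.
  + exists h; split=> [t|e] /=.
      apply: hG; split=> /=; first by rewrite subrr.
      by apply/esym/ext_exact; exists t.
    by have [p [Ge pe]] := Gtot e; rewrite (hG e p) //= /split_out pe.
- by constructor 2; apply/seteqP; split; [apply: NT' | apply: T'N].
- constructor 3; apply/seteqP; split=> // e _.
  have : (ext_out E @` N) (ext_out E e) by rewrite outN.
  case=> n Nn ne; rewrite -(subrK n e); apply: ND => //.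
  have /ext_exact[t <-] : ext_out E (e - n) = 0 by rewrite linearB ne subrr.
  by apply: T'N => //; exists t.
Qed.

Lemma nonsplit_finite_length : finite_length E.
Proof.
have [T'0 T'T] := ext_in_proper; have sT' := ext_in_submod.
have T'z : T' 0 by case: sT'.
exists 2, (fun i => match i with 0 => [set 0] | 1 => T' | _ => setT end).
split=> //; first by move=> [|[|i]] _ //; apply: submod0.
move=> [|[|i]] // _; split=> //.
- by move=> _ ->.
- by move=> /esym.
- move=> K /nonsplit_submod[->|->|->] _ KT; [by left|by right|].
  by case: T'T; apply/seteqP; split.
- move=> K /nonsplit_submod[->|->|->] T'K _; [|by left|by right].
  by case: T'0; apply/seteqP; split=> // _ ->.
Qed.

Lemma nonsplit_not_simple : ~ simple_mod E.
Proof.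
by have [T'0 T'T] := ext_in_proper; case=> _ /(_ _ ext_in_submod)[].
Qed.

(** A nonzero endomorphism has kernel 0 or [T']. Kernel 0 forces the image to be [E]. With kernel
    [T'], image [T'] would make [S] and [T] isomorphic, and image [E] would leave no possible value
    for the preimage of [T']. *)
Lemma nonsplit_division_endo : ~ isomorphic_mod S T -> division_ring (endo E).
Proof.
move=> nST; have [T'0 T'T] := ext_in_proper; have sT' := ext_in_submod.
split=> [E0|f f0].
  apply: T'0; apply/seteqP; split=> [e _|_ -> /=]; last by case: sT'.
  have := congr1 (fun g => endo_fun g e) E0.
  by rewrite /endo_fun /=.
pose fL : {linear E -> E} := f.
have kerf : is_submod (fL @^-1` [set 0]) by apply/submod_preimage/submod0.
have imf : is_submod (range fL) by apply/submod_image/submodT.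
have fnz : ~ forall e, fL e = 0.
  by move=> fz; apply: f0; apply: endoP => e; apply: fz.
have imN0 : range fL <> [set 0].
  move=> im0; apply: fnz => e; have : range fL (fL e) by exists e.
  by rewrite im0.
have kerP e : fL e = 0 -> (fL @^-1` [set 0]) e by [].
have pre : is_submod (fL @^-1` T') by apply/submod_preimage.
case: (nonsplit_submod kerf) => kE.
- have fI : injective fL.
    move=> x y fxy; apply/eqP; rewrite -subr_eq0; apply/eqP.
    have /kerP : fL (x - y) = 0 by rewrite linearB fxy subrr.
    by rewrite kE.
  have imT : range fL = setT.
    (* If [E] were mapped onto [T'], the image of [T'] could not be 0 by injectivity, nor [T'] since
       [E] already maps into it, nor [E]. *)
    case: (nonsplit_submod imf) => // imT'.
    have preT e : (fL @^-1` T') e by rewrite /preimage /= -imT'; exists e.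
    have im2 : is_submod (fL @` T') by apply/submod_image.
    have im2T : fL @` T' `<=` T' by move=> _ [e _ <-]; apply: preT.
    case: (nonsplit_submod im2) => im2E.
    + case: T'0; apply/seteqP; split=> [e T'e|_ ->]; last by case: sT'.
      suff /kerP : fL e = 0 by rewrite kE.
      by have : (fL @` T') (fL e) by [exists e]; rewrite im2E.
    + case: T'T; apply/seteqP; split=> // e _.
      have [e' T'e' /fI <- //] : (fL @` T') (fL e) by rewrite im2E; apply: preT.
    + case: T'T; apply/seteqP; split=> // e _.
      have : (fL @` T') e by rewrite im2E.
      exact: im2T.
  have [e'|v||g gG] := @linear_of_graph A E E (fun y x => fL x = y).
  + by have : range fL e' by [rewrite imT]; case=> e _ <-; exists e.
  + by rewrite -[RHS](linear0 fL); apply: fI.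
  + by move=> a u u' v v' <- <-; rewrite linearP.
  exists (g : endo E); split; apply: endoP => e; first exact: gG.
  have [e' _ <-] : range fL e by rewrite imT.
  by rewrite -[LHS]/(fL (g (fL e'))) (gG _ e').
- exfalso; case: (nonsplit_submod imf) => // imE.
    apply: nST.
    (* The map from [S] to [T] induced by [f], whose kernel and image are both [T']. *)
    pose G s t := exists2 e, ext_out E e = s & fL e = ext_in E t.
    have Gtot s : exists t, G s t.
      have [e <-] := @ext_out_surj _ _ _ E s.
      have [t _ te] : T' (fL e) by rewrite -imE; exists e.
      by exists t, e.
    have [//|t||g gG] := @linear_of_graph A S T G.
    + case=> e /ext_exact[t' te] ft.
      have fe0 : (fL @^-1` [set 0]) e by rewrite kE; exists t'.
      by apply: (@ext_in_inj _ _ _ E); rewrite -ft fe0 linear0.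
    + move=> a u u' v v' [e <- ev] [e' <- ev']; exists (a *: e + e').
        by rewrite linearP.
      by rewrite linearP ev ev' linearP.
    exists g; apply: inj_surj_bijective => [|t].
      move=> s s' gss'; apply/eqP; rewrite -subr_eq0; apply/eqP.
      have [t [e es et]] := Gtot (s - s').
      have /(gG _ _) : G (s - s') t by exists e.
      rewrite linearB gss' subrr => t0; rewrite -t0 linear0 in et.
      move: et => /kerP; rewrite kE => -[t' _ te].
      by rewrite -es; apply/ext_exact; exists t'.
    have [e _ et] : range fL (ext_in E t) by rewrite imE; exists t.
    by exists (ext_out E e); apply: gG; exists e.
  case: (nonsplit_submod pre) => pE.
  + apply: T'0; apply/seteqP; split=> [e T'e|_ ->]; last by case: sT'.
    have fe0 : fL e = 0 by have : (fL @^-1` [set 0]) e by rewrite kE.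
    have : (fL @^-1` T') e by rewrite /preimage /= fe0; case: sT'.
    by rewrite pE.
  + apply: T'0; apply/seteqP; split=> [e T'e|_ ->]; last by case: sT'.
    have [x _ xe] : range fL e by rewrite imE.
    have : T' x by rewrite -pE /preimage /= xe.
    by rewrite -kE /preimage /= => fx0; rewrite -xe fx0.
  + apply: T'T; apply/seteqP; split=> // e _.
    have [x _ <-] : range fL e by rewrite imE.
    by have : (fL @^-1` T') x by rewrite pE.
- by exfalso; apply: fnz => e; have : (fL @^-1` [set 0]) e by rewrite kE.
Qed.

End NonsplitExtensions.

Lemma CSL_totally_disconnected (R : pzRingType) :
  has_CSL (fun M : rmodType R => finite_length M) ->
  gabriel_totally_disconnected R.
Proof.
move=> csl S T sS sT nST; apply => E; apply: contrapT => Ensplit.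
apply: (nonsplit_not_simple sS sT (E:=E)); apply: csl.
  exact: nonsplit_finite_length.
exact: nonsplit_division_endo.
Qed.

Lemma maximal_avoiding (A : pzRingType) (M : lmodType A) (K0 : set M) (w : M) :
    is_submod K0 -> ~ K0 w ->
  exists K : set M, [/\ is_submod K, K0 `<=` K, ~ K w
    & forall N : set M, is_submod N -> K `<=` N -> ~ N w -> N `<=` K].
Proof.
move=> sK0 K0w; pose P (K : set M) := [/\ is_submod K, K0 `<=` K & ~ K w].
have [F FP Ftot|K [PK Kmax]] := @Zorn_bigcup _ [set K | P K \/ K = set0].
  have [[K FK PK]|noP] := pselect (exists2 K, F K & P K); last first.
    right; apply/seteqP; split=> // x [K FK Kx].
    by case: (FP _ FK) => [PK|K0E]; [case: noP; exists K | rewrite -K0E].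
  left; have FPx L x : F L -> L x -> P L.
    by move=> FL Lx; case: (FP L FL) => // L0; rewrite L0 in Lx.
  have [[Kz _ _] K0K _] := PK.
  split; first split; first by exists K.
  - move=> u v [L FL Lu] [L' FL' L'v].
    have [[_ LD _] _ _] := FPx _ _ FL Lu; have [[_ LD' _] _ _] := FPx _ _ FL' L'v.
    case: (Ftot _ _ FL FL') => LL'.
      by exists L' => //; apply: LD' => //; apply: LL'.
    by exists L => //; apply: LD => //; apply: LL'.
  - move=> a u [L FL Lu]; have [[_ _ LZ] _ _] := FPx _ _ FL Lu.
    by exists L => //; apply: LZ.
  - by move=> x /K0K Kx; exists K.
  - by case=> L FL Lw; have [_ _] := FPx _ _ FL Lw; apply.
have K0z : K0 0 by case: sK0.
have {}PK : P K.
  case: PK => // KE; case: (Kmax K0); last by left; split.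
  by rewrite KE; split=> // /(_ 0 K0z).
have [sK K0K Kw] := PK; exists K; split=> // N sN KN Nw.
apply: contrapT => NK; apply: (Kmax N); first by split.
by left; split=> // x /K0K /KN.
Qed.

(** * Nilpotent ideals *)

Section NilpotentIdeals.
Variables (R : pzRingType) (J : ideal R).

(* [kills l z] says that [J ^ l * z = 0]. *)
Fixpoint kills (l : nat) (z : R) : Prop :=
  if l is l'.+1 then forall x, J x -> kills l' (x * z) else z = 0.

Lemma killsD l y z : kills l y -> kills l z -> kills l (y + z).
Proof.
elim: l y z => [|l IH] y z /=; first by move=> -> ->; rewrite addr0.
by move=> ky kz x Jx; rewrite mulrDr; apply: IH; [apply: ky | apply: kz].
Qed.

Lemma killsMl l a z : kills l z -> kills l (a * z).
Proof.
case: l => [|l] /= kz; first by rewrite kz mulr0.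
move=> x Jx; rewrite mulrA; apply: kz.
exact: idealMr.
Qed.

Lemma kills_expr l x z : kills l z -> J x -> x ^+ l * z = 0.
Proof.
move=> kz Jx; elim: l z kz => [|l IH] z /= kz; first by rewrite kz mulr0.
by rewrite exprSr -mulrA; apply: IH => //; apply: kz.
Qed.

Lemma nilpotent_kills : nilpotent_ideal J -> exists n, kills n 1.
Proof.
case=> n nilJ; exists n.
suff killsP l z : (forall g : nat -> R, (forall i, J (g i)) ->
    \prod_(i < l) g i * z = 0) -> kills l z.
  by apply: killsP => g Jg; rewrite nilJ ?mul0r.
elim: l z => [|l IH] z nilz /=.
  have := nilz (fun=> 0); rewrite big_ord0 mul1r; apply=> i.
  exact: ideal0.
move=> x Jx; apply: IH => g Jg.
(* The factor [x] becomes the last entry of the sequence, next to [z]. *)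
have := nilz (fun i => if (i < l)%N then g i else x).
rewrite big_ord_recr /= ltnn mulrA => <- => [|i]; last by case: ifP.
by congr (_ * _ * _); apply: eq_bigr => i _; rewrite ltn_ord.
Qed.

(* The power [J ^ m], with [J ^ 0 = R]. *)
Inductive ideal_pow : nat -> R -> Prop :=
| ideal_pow0 x : ideal_pow 0 x
| ideal_pow1 x : J x -> ideal_pow 1 x
| ideal_powM m n x y : ideal_pow m x -> ideal_pow n y -> ideal_pow (m + n) (x * y)
| ideal_powD m x y : ideal_pow m x -> ideal_pow m y -> ideal_pow m (x + y).

Lemma ideal_pow_kills m x l z :
  ideal_pow m x -> kills (l + m) z -> kills l (x * z).
Proof.
move=> Jx; elim: Jx l z => {m x} [x|x Jx|m n x y _ IHx _ IHy|m x y _ IHx _ IHy] l z.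
- by rewrite addn0; apply: killsMl.
- by rewrite addn1 => /(_ _ Jx).
- by rewrite addnA -mulrA => kz; apply: IHx; apply: IHy.
- by move=> kz; rewrite mulrDl; apply: killsD; [apply: IHx | apply: IHy].
Qed.

Variable n : nat.
Hypothesis kills1 : kills n 1.

Lemma ideal_pow_eq0 x : ideal_pow n x -> x = 0.
Proof. by move=> Jx; rewrite -[x]mulr1; apply: (@ideal_pow_kills n x 0 1). Qed.

Lemma rad_expr0 x : J x -> x ^+ n = 0.
Proof. by move=> Jx; rewrite -[_ ^+ _]mulr1; apply: kills_expr. Qed.

Lemma one_sub_inv x : J x -> exists y, (1 - x) * y = 1 /\ y * (1 - x) = 1.
Proof.
(* The geometric series, which stops because [x ^+ n = 0]. *)
move=> Jx; exists (\sum_(i < n) x ^+ i).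
have E : (1 - x) * (\sum_(i < n) x ^+ i) = 1.
  by rewrite -opprB mulNr -subrX1 opprB rad_expr0 ?subr0.
split=> //; rewrite -[RHS]E mulrBl mulrBr mul1r mulr1; congr (_ - _).
by rewrite mulr_suml mulr_sumr; apply: eq_bigr => i _; rewrite -exprS -exprSr.
Qed.

Lemma idempotent_eq0 e : e * e = e -> J e -> e = 0.
Proof.
move=> ee /one_sub_inv[y [ey _]].
by rewrite -[e]mulr1 -ey mulrA mulrBr ee mulr1 subrr mul0r.
Qed.

(* With [u = x ^ N + (1 - x) ^ N], a unit congruent to 1, the element        *)
(* [x ^ N / u] is idempotent since [x ^ N * (1 - x) ^ N = (x - x ^ 2) ^ N = 0]. *)
Lemma lift_idempotent e x : J (x - x * x) -> e * x = x -> x * e = x ->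
  exists f, [/\ f * f = f, J (x - f), e * f = f & f * e = f].
Proof.
(* The exponent is [n.+1] so as to be positive: only then is [x ^+ N] congruent to [x] and absorbed
   by [e]. *)
move=> Jt ex xe; pose y := 1 - x; pose N := n.+1.
have cxy : GRing.comm x y by rewrite /GRing.comm /y mulrBl mulrBr mul1r mulr1.
have xy0 : x ^+ N * y ^+ N = 0.
  rewrite -exprMn_comm // exprSr rad_expr0 ?mul0r //.
  by rewrite /y mulrBr mulr1.
have powE z k : J (z - z * z) -> J (z - z ^+ k.+1).
  move=> Jz; elim: k => [|k IH]; first by rewrite subrr; apply: ideal0.
  rewrite -(subrKA (z * z)) exprS -mulrBr; apply: idealD => //.
  exact: idealMl.
have Jy : J (y - y * y).
  by rewrite -{1}[y]mul1r -mulrBl {1}/y opprB addrC subrK /y mulrBr mulr1.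
pose u := x ^+ N + y ^+ N.
have Ju : J (1 - u).
  have -> : 1 - u = (x - x ^+ N) + (y - y ^+ N).
    by rewrite addrACA -opprD [x + y]addrC /y subrK.
  by apply: idealD; apply: powE.
have [v []] := one_sub_inv Ju; rewrite opprB addrC subrK => uv vu.
have xu : x ^+ N * u = x ^+ N * x ^+ N by rewrite mulrDr xy0 addr0.
have ux : u * x ^+ N = x ^+ N * x ^+ N.
  by rewrite mulrDl (commrX N (commr_sym (commrX N cxy))) xy0 addr0.
have vx : v * x ^+ N = x ^+ N * v.
  by rewrite -[LHS]mulr1 -uv mulrA -[v * _ * _]mulrA xu -ux !mulrA vu mul1r.
have xx : x ^+ N = x ^+ N * x ^+ N * v by rewrite -xu -mulrA uv mulr1.
exists (x ^+ N * v); split.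
- by rewrite mulrA -[_ * v * _]mulrA vx !mulrA -xx.
- rewrite -(subrKA (x ^+ N)); apply: idealD; first exact: powE.
  rewrite -[X in X - _]mulr1 -mulrBr; apply: idealMl.
  by rewrite -{1}vu -[X in _ - X]mulr1 -mulrBr; apply: idealMl;
    rewrite -opprB; apply: idealN.
- by rewrite mulrA exprS mulrA ex.
- by rewrite -vx -mulrA exprSr -[_ * x * e]mulrA xe.
Qed.

End NilpotentIdeals.

(** * Decomposition of 1 into local idempotents *)

Section LocalIdempotents.
Variables (R : pzRingType) (J : ideal R) (n : nat).
Hypothesis kills1 : kills J n 1.
Hypothesis ssJ : semisimple_ring (quotient_ring J).

(** Every element of [e R] outside [J] generates [e R], so [e J] is its largest proper submodule.
    The equation holds in [R] itself, not just modulo [J]. *)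
Definition local_idempotent (e : R) : Prop :=
  [/\ e * e = e, ~ J e & forall x, J (e * x) \/ exists y, e * x * y = e].

(** Pulls back to [R] a complement of the image of [I] in the semisimple ring [R / J]. As [K]
    contains [J], the decomposition of 1 can be made exact. *)
Lemma ideal_compl (I : set R) :
    I 0 -> (forall x y, I x -> I y -> I (x + y)) -> (forall x a, I x -> I (x * a)) ->
  exists K : set R,
    [/\ forall x y, K x -> K y -> K (x + y), forall x a, K x -> K (x * a),
        forall x, J x -> K x, (forall x, I x -> K x -> J x)
      & exists x y, [/\ I x, K y & 1 = x + y]].
Proof.
move=> I0 ID IM.
pose N : set (regular_rmod (quotient_ring J)) := [set q | exists2 x, I x & q = quo J x].
have [|K [[K0 KD KZ] NK NKT]] := @ssJ N.
  split=> [|_ _ [x Ix ->] [y Iy ->]|b _ [x Ix ->]]; first by exists 0.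
    by exists (x + y); [exact: ID | exact: quo_addE].
  elim/quo_ind: b => a; exists (x * a); first exact: IM.
  exact: quo_mulE.
exists [set x | K (quo J x)]; split=> /=.
- by move=> x y Kx Ky; rewrite -quo_addE; apply: KD.
- by move=> x a Kx; rewrite -quo_mulE; apply: (KZ (quo J a)).
- by move=> x Jx; rewrite (_ : quo J x = quo J 0) //; apply/quoP; rewrite subr0.
- move=> x Ix Kx; have : (N `&` K) (quo J x) by split=> //; exists x.
  by rewrite NK => /quoP; rewrite subr0.
- have [_ [q [[x Ix ->] Kq E]]] := NKT (quo J 1).
  exists x, (1 - x); split; rewrite // ?[x + _]addrC ?subrK //.
  suff -> : quo J (1 - x) = q by [].
  rewrite -quo_addE -quo_oppE -[LHS]/(quo J 1 - quo J x) E.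
  by rewrite addrAC subrr add0r.
Qed.

(** In a semisimple ring the component of 1 in a right ideal is an idempotent generating it.
    Truncating by [e] on both sides keeps it under [e], and it is then lifted from [R / J] to
    [R]. *)
Lemma right_ideal_idempotent (I : set R) e :
    (forall x y, I x -> I y -> I (x + y)) -> (forall x a, I x -> I (x * a)) ->
    (forall x, J x -> I x) -> e * e = e -> (forall x, I x -> I (e * x)) ->
  exists f, [/\ f * f = f, e * f = f, f * e = f, I f
    & forall z, I z -> J (e * z - f * z)].
Proof.
move=> ID IM JI ee eI.
pose I' : set R := [set x | I x /\ J (x - e * x)].
have I'M x a : I' x -> I' (x * a).
  by case=> Ix Jx; split; [exact: IM | rewrite mulrA -mulrBl; apply: idealMr].
have I'D x y : I' x -> I' y -> I' (x + y).
  move=> [Ix Jx] [Iy Jy]; split; first exact: ID.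
  by rewrite mulrDr opprD addrACA; apply: idealD.
have eI' x : I x -> I' (e * x).
  by move=> /eI Iex; split=> //; rewrite mulrA ee subrr; apply: ideal0.
have [|//|//|K [KD KM JK IK [x0 [y0 [[Ix0 Jx0] Ky0 E]]]]] := @ideal_compl I'.
  by split; rewrite ?mulr0 ?subrr; [apply: JI|]; apply: ideal0.
pose x := e * x0 * e; pose y := e * y0 * e.
have yE : y = e - x.
  by apply/esym/eqP; rewrite subr_eq -mulrDl -mulrDr [y0 + x0]addrC -E mulr1 ee.
have ex : e * x = x by rewrite /x !mulrA ee.
have xe : x * e = x by rewrite /x -!mulrA ee.
have Ix : I' x by apply/I'M/eI'.
have Ky : K y.
  rewrite -[y](subrK (y0 * e)) addrC; apply: KD; first exact: KM.
  apply: JK; have -> : y - y0 * e = (x0 - e * x0) * e.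
    have -> : y0 = 1 - x0 by rewrite E addrAC subrr add0r.
    by rewrite yE !mulrBl mul1r opprB addrC subrKA.
  exact: idealMr.
have yxE : x - x * x = y * x.
  by rewrite yE mulrBl ex.
(* This element equals [y * x], so it lies in both [I'] and [K], whose common elements are in
   [J]. *)
have Jx : J (x - x * x).
  apply: IK; last by rewrite yxE; apply: KM.
  rewrite -mulrN1 -mulrA; apply: I'D => //; exact: I'M.
have [f [ff Jxf ef fe]] := lift_idempotent kills1 Jx ex xe.
exists f; split=> //.
  rewrite -[f](subKr x) -mulrN1; apply: ID; first by case: Ix.
  by apply: IM; apply: JI.
move=> z Iz; have zE : e * z - x * z = y * z by rewrite yE mulrBl.
rewrite -(subrKA (x * z)) -(mulrBl _ x); apply: idealD; last exact: idealMr.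
apply: IK; last by rewrite zE; apply: KM.
rewrite -mulrN1 -mulrA; apply: I'D; [exact: eI' | exact: I'M].
Qed.

(** If [e] is not local, some [e x] outside [J] does not generate [e R]; an idempotent generating
    [e x R + J] modulo [J] splits [e] properly. *)
Lemma idempotent_split e : e * e = e -> ~ J e -> ~ local_idempotent e ->
  exists f, [/\ f * f = f, e * f = f, f * e = f, ~ J f & ~ J (e - f)].
Proof.
move=> ee Je nloc.
have [x [Jx nx]] : exists x, ~ J (e * x) /\ forall y, e * x * y <> e.
  apply: contrapT => nx; apply: nloc; split=> // x.
  have [|Jx] := pselect (J (e * x)); first by left.
  right; apply: contrapT => ny; apply: nx; exists x; split=> // y xy.
  by apply: ny; exists y.
have [|||//||f [ff ef fe [r Jr] Jf]] :=
  @right_ideal_idempotent [set z | exists r, J (z - e * x * r)] e.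
- move=> u v [r Jr] [s Js]; exists (r + s).
  by rewrite mulrDr opprD addrACA; apply: idealD.
- by move=> u a [r Jr]; exists (r * a); rewrite mulrA -mulrBl; apply: idealMr.
- by move=> u Ju; exists 0; rewrite mulr0 subr0.
- move=> u [r Jr]; exists r; have -> : e * u - e * x * r = e * (u - e * x * r).
    by rewrite mulrBr !mulrA ee.
  exact: idealMl.
exists f; split=> // [Jf'|Jef].
  apply: Jx; rewrite -[_ * _](subrK (f * (e * x))); apply: idealD; last exact: idealMr.
  rewrite -{1}ee -mulrA; apply: Jf; exists 1; rewrite mulr1 subrr; exact: ideal0.
have Jd : J (e - e * x * r) by rewrite -(subrKA f); apply: idealD.
have [z [dz _]] := one_sub_inv kills1 (idealMr e Jd).
apply: (nx (r * e * z)); rewrite -[RHS]mulr1 -dz !mulrA; congr (_ * z).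
by rewrite mulrBr mulr1 mulrBl ee mulrBr !mulrA ee subKr.
Qed.

(** Both products appear because [pairwise] compares an element only with later ones. *)
Definition local_decomposition (e : R) (s : seq R) : Prop :=
  [/\ forall x, x \in s -> [/\ local_idempotent x, e * x = x & x * e = x],
      pairwise (fun x y => (x * y == 0) && (y * x == 0)) s
    & \sum_(x <- s) x = e].

Lemma local_decomposition_cat e f s t :
  e * e = e -> e * f = f -> f * e = f -> f * f = f ->
  local_decomposition f s -> local_decomposition (e - f) t ->
  local_decomposition e (s ++ t).
Proof.
move=> ee ef fe ff [sl sp sE] [tl tp tE].
have [fe' e'f] : f * (e - f) = 0 /\ (e - f) * f = 0.
  by rewrite mulrBr mulrBl ef fe ff subrr.
split; last by rewrite big_cat /= sE tE addrC subrK.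
  move=> x; rewrite mem_cat => /orP[/sl[xl fx xf]|/tl[xl gx xg]].
    by split=> //; [rewrite -fx mulrA ef | rewrite -xf -mulrA fe].
  by split=> //; [rewrite -gx mulrA mulrBr ee ef | rewrite -xg -mulrA mulrBl ee fe].
rewrite pairwise_cat sp tp !andbT; apply/allrelP => x y /sl[_ fx xf] /tl[_ gy yg].
have -> : x * y = 0 by rewrite -xf -gy -mulrA [f * _]mulrA fe' mul0r mulr0.
have -> : y * x = 0 by rewrite -yg -fx -mulrA [(e - f) * _]mulrA e'f mul0r mulr0.
by rewrite eqxx.
Qed.

Lemma ex_local_decomposition : exists s, local_decomposition 1 s.
Proof.
pose good e := exists s, local_decomposition e s.
pose bad e := e * e = e /\ ~ good e.
(* A bad [e] is not local, and one of its two summands is bad again. The implication stands under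
   the existential so that [choice] gives a total function [h]. *)
have step e : exists e', bad e -> [/\ bad e', e' * e = e', e * e' = e' & ~ J (e - e')].
  have [[ee ng]|nb] := pselect (bad e); last by exists 0.
  have Je : ~ J e.
    move=> /(idempotent_eq0 kills1 ee) e0; apply: ng; exists [::].
    by split; rewrite ?big_nil.
  have [el|/(idempotent_split ee Je)[f [ff ef fe Jf Jef]]] :=
    pselect (local_idempotent e).
    case: ng; exists [:: e]; split; rewrite ?big_seq1 // => x.
    by rewrite inE => /eqP ->.
  have [[s gf]|nf] := pselect (good f); last by exists f.
  exists (e - f) => _.
  rewrite subKr mulrBl mulrBr ee fe ef; split=> //; split.
    by rewrite !(mulrBl, mulrBr) ee fe ef ff subrr subr0.
  by case=> t gt; apply: ng; exists (s ++ t); apply: local_decomposition_cat gf gt.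
apply: contrapT => n1; have [h hP] := choice step.
pose g i := iter i h 1.
have gP i : bad (g i) by elim: i => [|i IH]; [rewrite /bad mulr1 | case: (hP _ IH)].
have gD i k : g (i + k)%N * g i = g (i + k)%N.
  elim: k => [|k IH]; first by rewrite addn0; case: (gP i).
  by rewrite addnS /=; have [_ <- _ _] := hP _ (gP (i + k)%N); rewrite -mulrA IH.
have gle i k : (i <= k)%N -> g k * g i = g k by move/subnKC <-.
(* The right ideal of the z with g i * z in J for some i is the union of the  *)
(* strictly increasing chain (1 - g i) R + J, so it is not of the form        *)
(* f R + J: f would belong to some member of the chain.                       *)
have [|||||f [ff _ _ [i Jf] If]] :=
  @right_ideal_idempotent [set z | exists i, J (g i * z)] 1.
- move=> x y [i Jx] [k Jy]; exists (maxn i k); rewrite mulrDr; apply: idealD.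
    by rewrite -(gle _ _ (leq_maxl i k)) -mulrA; apply: idealMl.
  by rewrite -(gle _ _ (leq_maxr i k)) -mulrA; apply: idealMl.
- by move=> x a [i Jx]; exists i; rewrite mulrA; apply: idealMr.
- by move=> x Jx; exists 0%N; apply: idealMl.
- by rewrite mulr1.
- by move=> x; rewrite mul1r.
have [_ hg gh] := hP _ (gP i); apply; have [gg _] := gP i.
have -> : g i - h (g i) = g i * (1 * (g i - h (g i)) - f * (g i - h (g i))) +
    g i * f * (g i - h (g i)).
  by rewrite mul1r mulrBr !mulrA subrK mulrBr gg gh.
apply: idealD; last exact: idealMr.
apply/idealMl/If; exists i.+1; rewrite mulrBr hg.
have [[-> _] _ _ _] := hP _ (gP i); rewrite subrr; exact: ideal0.
Qed.
End LocalIdempotents.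

Lemma ex_local_idempotents (R : pzRingType) (J : ideal R) (n : nat) :
    kills J n 1 -> semisimple_ring (quotient_ring J) ->
  exists m (e : 'I_m -> R), [/\ forall i, local_idempotent J (e i),
    forall i j, i != j -> e i * e j = 0 & \sum_i e i = 1].
Proof.
move=> kills1 ssJ; have [s [sl sp sE]] := ex_local_decomposition kills1 ssJ.
exists (size s), (fun i => s`_i); split=> [i|i j ij|].
- by case: (sl s`_i); rewrite ?mem_nth.
- have /(pairwiseP 0) sp' := sp.
  case: (ltngtP i j) => [lt_ij|lt_ji|/val_inj/eqP]; last by rewrite (negPf ij).
    by have /andP[/eqP] := sp' i j (ltn_ord i) (ltn_ord j) lt_ij.
  by have /andP[_ /eqP] := sp' j i (ltn_ord j) (ltn_ord i) lt_ji.
- by rewrite -sE [RHS](big_nth 0) big_mkord.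
Qed.

(** * Simple quotients and simple submodules *)

Section RightAction.
Variables (R : pzRingType) (M : rmodType R).
Implicit Types (v w : M) (x y : R).

(** Taking [x] in [R] rather than [R^c] makes products appear in the order of the right action. *)
Definition ract v x : M := (x : R^c) *: v.
Local Notation "v ** x" := (ract v x) (at level 40, left associativity).

Lemma ractA v x y : v ** x ** y = v ** (x * y).
Proof. exact: scalerA. Qed.
Lemma ract1 v : v ** 1 = v.
Proof. exact: scale1r. Qed.
Lemma ract0 v : v ** 0 = 0.
Proof. exact: scale0r. Qed.
Lemma ract0l x : 0 ** x = 0 :> M.
Proof. exact: scaler0. Qed.
Lemma ractDr v x y : v ** (x + y) = v ** x + v ** y.
Proof. exact: scalerDl. Qed.
Lemma ractBr v x y : v ** (x - y) = v ** x - v ** y.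
Proof. exact: scalerBl. Qed.
Lemma ractDl v w x : (v + w) ** x = v ** x + w ** x.
Proof. exact: scalerDr. Qed.
Lemma ractBl v w x : (v - w) ** x = v ** x - w ** x.
Proof. exact: scalerBr. Qed.
Lemma ract_sumr v (I : Type) (r : seq I) (P : pred I) (F : I -> R) :
  v ** (\sum_(i <- r | P i) F i) = \sum_(i <- r | P i) v ** F i.
Proof. exact: (big_morph _ (ractDr v) (ract0 v)). Qed.

Lemma submod_ract (K : set M) v x : is_submod K -> K v -> K (v ** x).
Proof. by case=> _ _ KZ; apply: KZ. Qed.

(* When K is a submodule not containing w, the following says that the       *)
(* module (w R + K) / K is simple.                                            *)
Definition simple_at (K : set M) w : Prop :=
  [/\ is_submod K, ~ K w & forall x, K (w ** x) \/ exists y, K (w ** (x * y) - w)].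

Lemma simple_at0 w : simple_at [set 0] w -> (forall v, exists x, v = w ** x) ->
  simple_mod M.
Proof.
case=> _ w0 wP wT; split; first by exists w.
move=> N sN; have [N0|] := pselect (N `<=` [set 0]).
  by left; apply/seteqP; split=> // _ ->; case: sN.
move=> /existsNP[u /not_implyP[Nu u0]]; right; apply/seteqP; split=> // v _.
have [x ux] := wT u; have [z ->] := wT v.
case: (wP x) => [/= wx0|[y]]; first by case: u0; rewrite ux.
rewrite /= => /eqP; rewrite subr_eq0 => /eqP wxy.
by rewrite -wxy -ractA -ux ractA; apply: submod_ract.
Qed.

Lemma simple_at_absorb (K : set M) w : simple_at K w -> forall x, ~ K (w ** x) ->
  exists y, K (w ** (x * y) - w).
Proof. by case=> _ _ wP x nKx; case: (wP x). Qed.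

Lemma simple_at_ract (K : set M) w x :
  simple_at K w -> ~ K (w ** x) -> simple_at K (w ** x).
Proof.
move=> sw nKx; have [sK Kw wP] := sw; split=> // y; rewrite !ractA.
have [|nK] := pselect (K (w ** (x * y))); first by left.
have [z Kz] := simple_at_absorb sw nK; right; exists (z * x).
by rewrite ractA !mulrA -[w ** (_ * x)]ractA -ractBl; apply: submod_ract.
Qed.

Variables (J : ideal R) (n m : nat) (e : 'I_m -> R).
Hypothesis kills1 : kills J n 1.
Hypothesis eloc : forall i, local_idempotent J (e i).
Hypothesis e1 : \sum_i e i = 1.

Lemma ract_idempotents v : v = \sum_i v ** e i.
Proof. by rewrite -ract_sumr e1 ract1. Qed.

(** Acting on [w] modulo [K] sends [e i J] to 0, so the image of [e i R] is a nonzero quotient of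
    the simple module [e i R / e i J]. *)
Lemma simple_at_local (K : set M) w i : is_submod K -> (forall x, J x -> K (w ** x)) ->
  ~ K (w ** e i) -> simple_at K (w ** e i).
Proof.
move=> sK KJ nKw; split=> // x; rewrite !ractA.
have [_ _ /(_ x)[Jx|[y xy]]] := eloc i; first by left; apply: KJ.
by right; exists y; rewrite ractA mulrA xy subrr; case: sK.
Qed.

(** Each [v e_i] outside [K] generates a simple module over [K]. By maximality of [K] that module
    contains [w], hence is generated by [w]. *)
Lemma maximal_avoiding_top (K : set M) w v : is_submod K -> ~ K w ->
    (forall N : set M, is_submod N -> K `<=` N -> ~ N w -> N `<=` K) ->
    (forall x, J x -> K (v ** x)) ->
  exists r, K (v - w ** r).
Proof.
move=> sK nKw Kmax KJ; have [K0 KD _] := sK.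
suff /choice[r rP] i : exists r, K (v ** e i - w ** r).
  exists (\sum_i r i); rewrite {1}[v]ract_idempotents ract_sumr -sumrB.
  exact: submod_sum.
have [Kv|nKv] := pselect (K (v ** e i)); first by exists 0; rewrite ract0 subr0.
have [_ _ vP] := simple_at_local sK KJ nKv.
pose N : set M := [set u | exists y, K (u - v ** e i ** y)].
have sN : is_submod N.
  split=> [|u u' [y Ky] [y' Ky']|a u [y Ky]].
  - by exists 0; rewrite ract0 subr0.
  - by exists (y + y'); rewrite ractDr opprD addrACA; apply: KD.
  - exists (y * a); rewrite -[v ** _ ** _]ractA -[a *: u]/(u ** a) -ractBl.
    exact: submod_ract.
have KN : K `<=` N by move=> u Ku; exists 0; rewrite ract0 subr0.
have [y Ky] : N w.
  apply: contrapT => nNw; apply: nKv; apply: (Kmax N) => //.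
  by exists 1; rewrite ract1 subrr.
have [Kvy|[z Kz]] := vP y.
  by case: nKw; rewrite -(subrK (v ** e i ** y) w); apply: KD.
exists z; rewrite -opprB; apply: submodN => //.
rewrite -(subrKA (v ** e i ** y ** z)) -ractBl; apply: KD; first exact: submod_ract.
by rewrite ractA.
Qed.

(* M J <> M, by nilpotency. *)
Lemma simple_quotient : (exists v : M, v <> 0) ->
  exists (K : set M) w, simple_at K w /\ forall v, exists r, K (v - w ** r).
Proof.
move=> [v0 v0P].
(* This is [M J], the least submodule containing all [u x] with [x] in [J]. *)
pose K0 : set M := [set v | forall N : set M, is_submod N ->
  (forall u x, J x -> N (u ** x)) -> N v].
have sK0 : is_submod K0.
  split=> [N []//|u v Ku Kv N sN JN|a u Ku N sN JN]; have [_ ND NZ] := sN.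
    by apply: ND; [apply: Ku | apply: Kv].
  by apply: NZ; apply: Ku.
have K0J u x : J x -> K0 (u ** x) by move=> Jx N sN; apply.
have [v K0v] : exists v, ~ K0 v.
  apply: contrapT => nK0; have {nK0} K0T v : K0 v.
    by apply: contrapT => K0v; apply: nK0; exists v.
  (* If [M J = M], induction on [l] shows that such a [z] kills [M]: the [v] with [v R z = 0] form a
     submodule containing [M J]. Then [z = 1] gives [M = 0]. *)
  suff kP l z v : kills J l z -> v ** z = 0.
    by apply: v0P; rewrite -(ract1 v0); apply: kP kills1.
  elim: l z v => [|l IH] z v /= kz; first by rewrite kz ract0.
  rewrite -[z]mul1r; apply: (K0T v [set v | forall r, v ** (r * z) = 0]).
    split=> /= [r|u u' uz u'z r|a u uz r]; first by rewrite ract0l.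
      by rewrite ractDl uz u'z addr0.
    by rewrite -[a *: u]/(u ** a) ractA mulrA uz.
  by move=> u x Jx r; rewrite ractA; apply: IH; rewrite mulrA; apply: kz; apply: idealMr.
have [i K0i] : exists i, ~ K0 (v ** e i).
  apply: contrapT => nK0; apply: K0v; rewrite [v]ract_idempotents.
  by apply: submod_sum => // i _; apply: contrapT => K0i; apply: nK0; exists i.
have [K [sK K0K nKw Kmax]] := maximal_avoiding sK0 K0i.
exists K, (v ** e i); split.
  by apply: simple_at_local => // x Jx; apply: K0K; apply: K0J.
move=> u; apply: maximal_avoiding_top => // x Jx.
by apply: K0K; apply: K0J.
Qed.

(** Some nonzero vector is killed by [J]: otherwise [v0] could be multiplied by [n] elements of [J]
    in turn without vanishing. *)
Lemma simple_sub : (exists v : M, v <> 0) -> exists w, simple_at [set 0] w.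
Proof.
move=> [v0 v0P].
suff [v vP vJ] : exists2 v, v <> 0 & forall x, J x -> v ** x = 0.
  have [i vi] : exists i, v ** e i <> 0.
    apply: contrapT => nv; apply: vP; rewrite [v]ract_idempotents big1 // => i _.
    by apply: contrapT => vi; apply: nv; exists i.
  by exists (v ** e i); apply: simple_at_local => //; apply: submod0.
apply: contrapT => nv.
suff [p Jp]: exists2 p, ideal_pow J n p & v0 ** p <> 0.
  by rewrite (ideal_pow_eq0 kills1 Jp) ract0.
elim: n => [|l [p Jp vp]]; first by exists 1; [apply: ideal_pow0 | rewrite ract1].
have [x Jx vx] : exists2 x, J x & v0 ** p ** x <> 0.
  apply: contrapT => nx; apply: nv; exists (v0 ** p) => // x Jx.
  by apply: contrapT => vx; apply: nx; exists x.
exists (p * x); last by rewrite -ractA.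
by rewrite -addn1; apply: ideal_powM => //; apply: ideal_pow1.
Qed.

(* M / K and w' R being isomorphic, M -> M / K -> w' R -> M is a nonzero      *)
(* endomorphism of M, hence onto.                                             *)
Lemma simple_of_top_bottom (K : set M) w w' : division_ring (endo M) ->
    simple_at K w -> (forall v, exists r, K (v - w ** r)) ->
    simple_at [set 0] w' -> (forall x, K (w ** x) -> w' ** x = 0) ->
  simple_mod M.
Proof.
move=> [_ divM] sw wT sw' ww'; have [sK nKw _] := sw; have [K0 KD _] := sK.
have [_ w'0 _] := sw'.
have [//|v|a u u' v v'|g gP] :=
  @linear_of_graph R^c M M (fun u v => exists2 r, K (u - w ** r) & v = w' ** r).
- by move=> u; have [r Kr] := wT u; exists (w' ** r), r.
- case=> r Kr ->; apply: ww'; rewrite -[w ** r]opprK; apply: submodN => //.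
  by rewrite -sub0r.
- case=> r Kr -> [r' Kr' ->]; exists (r * a + r'); rewrite ractDr -ractA //.
  rewrite opprD addrACA -[_ *: u]/(u ** a) -ractBl.
  by apply: KD => //; apply: submod_ract.
have gw : g w = w' by apply: gP; exists 1; rewrite ract1 ?subrr.
have gnz : (g : endo M) <> 0.
  by move=> g0; apply: w'0; rewrite -gw; have := congr1 (fun h => endo_fun h w) g0.
have [h [_ gh]] := divM _ gnz.
apply: (simple_at0 sw') => v.
have ghv : g (endo_fun h v) = v := congr1 (fun f => endo_fun f v) gh.
have [r Kr] := wT (endo_fun h v); exists r; rewrite -[LHS]ghv.
by apply: gP; exists r.
Qed.

End RightAction.

(** * Modules over products of matrix rings *)

(* The map [iota] identifies L with a corner e R e of R, where e = [iota 1]. *)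
Lemma corner_annihilator (R L : pzRingType) (iota : L -> R) (pi : R -> L)
    (M : rmodType R) (K : set M) (w : M) :
    {morph iota : x y / x - y} -> {morph iota : x y / x * y} ->
    (forall x, iota 1 * x * iota 1 = iota (pi x)) -> local_ring L ->
    simple_at K w -> ract w (iota 1) = w ->
  forall l, K (ract w (iota l)) <-> rad_set l.
Proof.
move=> iB iM ipi [_ divL] sw we; have [sK nKw wP] := sw.
have i0 : iota 0 = 0 by rewrite -(subrr 0) iB subrr.
have iD x y : iota (x + y) = iota x + iota y.
  by rewrite -{1}[y]opprK iB -[- y]sub0r iB i0 sub0r opprK.
have radK l : rad_set l -> K (ract w (iota l)).
  (* This annihilator is a maximal right ideal of [L], so it contains the radical. *)
  move=> rl; pose N : set (regular_rmod L) := [set y : L | K (ract w (iota y))].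
  suff maxN : maximal_submod N by exact: (rl N maxN).
  have sN : is_submod N.
    have [K0 KD KZ] := sK; split=> [|x y Kx Ky|a x Kx]; rewrite /N /=.
    - by rewrite i0 ract0.
    - by rewrite iD ractDr; apply: KD.
    - have -> : iota (a *: x) = iota (x : L) * iota (a : L) by exact: iM.
      by rewrite -ractA; apply: (submod_ract _ sK).
  split=> // [NT|K' sK' NK'].
    by apply: nKw; rewrite -we -[K _]/(N 1) NT.
  have [K'N|] := pselect (K' `<=` N); first by left; apply/seteqP.
  move=> /existsNP[y /not_implyP[K'y nNy]]; right.
  have [z Kz] := simple_at_absorb sw nNy.
  suff K'1 : K' 1.
    apply/seteqP; split=> // x _; have [_ _ KZ] := sK'.
    by have := KZ x 1 K'1; rewrite -[_ *: _]/((1 : L) * x) mul1r.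
  have Ny : N ((y : L) * pi z - 1).
    rewrite /N /= iB iM -ipi.
    have -> : iota y * (iota 1 * z * iota 1) = iota y * z * iota 1.
      by rewrite !mulrA -iM mulr1.
    rewrite -[X in _ - X]mul1r -mulrBl -ractA.
    by apply: (submod_ract _ sK); rewrite ractBr ract1.
  have [_ _ KZ] := sK'; have K'yz : K' ((y : L) * pi z) by apply: (KZ (pi z)).
  by have := submodB sK' K'yz (NK' _ Ny); rewrite [_ - _]subKr.
(* Outside the radical, [l] has an inverse [y] modulo it. Both [w (l y - 1)] and [w l y] then lie in
   [K], which forces [w] into [K]. *)
move=> l; split=> [Kl|]; last exact: radK.
apply: contrapT => nl; have [l0|q [_ ]] := divL (quo (rad L) l).
  by apply: nl; move/quoP: l0; rewrite subr0.
elim/quo_ind: q => y qly.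
have /quoP/radK : quo (rad L) (l * y) = quo (rad L) 1 by rewrite -quo_mulE.
rewrite iB iM ractBr we => Kly.
apply: nKw; rewrite -(subKr (ract w (iota l * iota y)) w).
by apply: submodB => //; rewrite -ractA; apply: (submod_ract _ sK).
Qed.

Section Blocks.
Variables (I : finType) (B : I -> pzRingType).

Definition block (i : I) (x : B i) : prod_ring B :=
  [ffun j => dfwith (fun j => 0 : B j) x j].

Lemma block_in i (x : B i) : block x i = x.
Proof. by rewrite ffunE dfwith_in. Qed.

Lemma block_out i j (x : B i) : i != j -> block x j = 0.
Proof. by move=> ij; rewrite ffunE dfwith_out. Qed.

Lemma prod_mulE (f g : prod_ring B) i : (f * g) i = f i * g i.
Proof. by rewrite ffunE. Qed.

Lemma blockMl i (x : B i) (f : prod_ring B) : f * block x = block (f i * x).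
Proof.
apply/ffunP => j; rewrite prod_mulE; have [<-|ij] := eqVneq i j.
  by rewrite !block_in.
by rewrite !block_out // mulr0.
Qed.

Lemma blockMr i (x : B i) (f : prod_ring B) : block x * f = block (x * f i).
Proof.
apply/ffunP => j; rewrite prod_mulE; have [<-|ij] := eqVneq i j.
  by rewrite !block_in.
by rewrite !block_out // mul0r.
Qed.

Lemma prod_subE (f g : prod_ring B) i : (f - g) i = f i - g i.
Proof. by rewrite !ffunE. Qed.

Lemma blockB i : {morph @block i : x y / x - y}.
Proof.
move=> x y; apply/ffunP => j; rewrite prod_subE; have [<-|ij] := eqVneq i j.
  by rewrite !block_in.
by rewrite !block_out // subr0.
Qed.

Lemma prod_sumE (T : Type) (r : seq T) (P : pred T) (F : T -> prod_ring B) j :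
  (\sum_(t <- r | P t) F t) j = \sum_(t <- r | P t) F t j.
Proof. by apply: (big_morph (fun f : prod_ring B => f j)) => [f g|]; rewrite ffunE. Qed.

Lemma sum_block1 : \sum_i block (1 : B i) = 1.
Proof.
apply/ffunP => j; rewrite prod_sumE (bigD1 j) //= block_in big1 ?addr0 ?ffunE //.
by move=> i ij; rewrite block_out.
Qed.

Lemma block_sum i (T : Type) (r : seq T) (P : pred T) (F : T -> B i) :
  block (\sum_(t <- r | P t) F t) = \sum_(t <- r | P t) block (F t).
Proof.
apply/ffunP => j; rewrite prod_sumE; have [<-|ij] := eqVneq i j.
  by rewrite block_in; apply: eq_bigr => t _; rewrite block_in.
by rewrite block_out // big1 // => t _; rewrite block_out.
Qed.

End Blocks.

Lemma delta_mx_corner (L : pzRingType) n (X : 'M[L]_n) (p : 'I_n) :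
  delta_mx p p *m X *m delta_mx p p = (X p p)%:M *m delta_mx p p.
Proof.
apply/matrixP => i j; rewrite mul_scalar_mx !mxE (bigD1 p) //= big1 => [|k kp].
  rewrite addr0 !mxE (bigD1 p) //= big1 => [|k kp]; last first.
    by rewrite !mxE (negPf kp) andbF mul0r.
  rewrite addr0 !mxE eqxx /= andbT.
  by case: eqP => _ /=; rewrite ?mul1r ?mul0r ?mulr0.
by rewrite !mxE (negPf kp) mulr0.
Qed.

Lemma sum_delta_mx (L : pzRingType) n (q : 'I_n) :
  \sum_p delta_mx p q *m delta_mx q p = 1%:M :> 'M[L]_n.
Proof.
rewrite mx1_sum_delta; apply: eq_bigr => p _.
by rewrite mul_delta_mx.
Qed.

(** The action of a central [c] is an endomorphism, and a nonzero idempotent of a division ring is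
    1. *)
Lemma central_idempotent_trivial (R : pzRingType) (M : rmodType R) (c : R) :
    division_ring (endo M) -> c * c = c -> (forall x, x * c = c * x) ->
    (exists v : M, ract v c <> 0) ->
  forall v : M, ract v c = v.
Proof.
move=> [_ divM] cc cR [v0 v0c].
have th_lin : linear (fun v : M => ract v c).
  move=> a u v; rewrite ractDl; congr (_ + _).
  by rewrite -[a *: u]/(ract u a) ractA cR -ractA.
pose th : {linear M -> M} := HB.pack (fun v : M => ract v c)
  (GRing.isLinear.Build _ M M *:%R (fun v : M => ract v c) th_lin).
have th0 : (th : endo M) <> 0.
  by move=> th0; apply: v0c; have := congr1 (fun f => endo_fun f v0) th0.
have thth : (th : endo M) * (th : endo M) = th.
  by apply: endoP => v; rewrite -[LHS]/(ract (ract v c) c) ractA cc.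
have [g [gth _]] := divM _ th0.
have : g * ((th : endo M) * (th : endo M)) = g * th by rewrite thth.
by rewrite mulrA gth mul1r => th1 v; have := congr1 (fun f => endo_fun f v) th1.
Qed.

Lemma matrix_rings_CSL (R : pzRingType) : semiprimary R ->
  product_of_matrix_rings_over_local_rings R -> has_CSL (fun M : rmodType R => True).
Proof.
move=> [nilR ssR] [k [n [L [n0 locL [phi [psi phiK psiK]]]]]] M _ divM.
have [N killsN] := nilpotent_kills nilR.
have [m [e [eloc _ e1]]] := ex_local_idempotents killsN ssR.
have M0 : exists v : M, v <> 0.
  apply: contrapT => nv; case: divM => + _; apply; apply: endoP => v.
  by apply: contrapT => v1; apply: nv; exists v => v0; apply: v1; rewrite v0.
have psiB : {morph psi : x y / x - y}.
  by move=> x y; apply: (can_inj phiK); rewrite rmorphB !psiK.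
have psiM : {morph psi : x y / x * y}.
  by move=> x y; apply: (can_inj phiK); rewrite rmorphM !psiK.
have psi1 : psi 1 = 1 by apply: (can_inj phiK); rewrite psiK rmorph1.
have psiS (T : finType) F : psi (\sum_(t : T) F t) = \sum_(t : T) psi (F t).
  by apply: (can_inj phiK); rewrite rmorph_sum psiK; apply: eq_bigr => t _; rewrite psiK.
pose B i : pzRingType := 'M[L i]_(n i).
pose c i : R := psi (block (1 : B i)).
have [i [v0 v0c]] : exists i (v : M), ract v (c i) <> 0.
  have [v v0] := M0; apply: contrapT => nc; apply: v0.
  rewrite -[v]ract1 -psi1 -sum_block1 psiS ract_sumr big1 // => i _.
  by apply: contrapT => vc; apply: nc; exists i, v.
have Mc : forall v : M, ract v (c i) = v.
  apply: central_idempotent_trivial => //; last by exists v0.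
    by rewrite -psiM blockMl block_in mulr1.
  by move=> x; rewrite -[x]phiK -!psiM blockMl blockMr mul1r mulr1.
pose p0 : 'I_(n i) := Ordinal (n0 i).
(* Matrix units in column [p0], and below in row [p0]: they move a generator of a simple module into
   the corner at [p0]. *)
pose a p : R := psi (block (delta_mx p p0 : B i)).
pose b p : R := psi (block (delta_mx p0 p : B i)).
have ab : \sum_p a p * b p = c i.
  rewrite /c -[1 : B i](sum_delta_mx _ p0) block_sum psiS.
  by apply: eq_bigr => p _; rewrite -psiM blockMl block_in.
pose iota (l : L i) : R := psi (block (l%:M *m delta_mx p0 p0 : B i)).
pose pi (x : R) : L i := (phi x i : B i) p0 p0.
have iB : {morph iota : x y / x - y}.
  by move=> x y; rewrite /iota raddfB mulmxBl blockB psiB.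
have iM : {morph iota : x y / x * y}.
  move=> x y; rewrite /iota -psiM blockMl block_in; congr (psi (block _)).
  rewrite scalar_mxM -[RHS]mulmxA [delta_mx p0 p0 *m (_ *m _)]mulmxA delta_mx_corner.
  by rewrite mxE eqxx mulmxA.
have i1 : iota 1 = a p0 by rewrite /iota mul1mx.
have ipi x : iota 1 * x * iota 1 = iota (pi x).
  rewrite /iota mul1mx -[x in LHS]phiK -!psiM blockMl blockMr block_in.
  by congr (psi (block _)); apply: delta_mx_corner.
have ae p : a p * iota 1 = a p.
  by rewrite i1 -psiM blockMl block_in; congr (psi (block _)); apply: mul_delta_mx.
have eqv (K : set M) w : simple_at K w -> exists p, ~ K (ract w (a p)).
  case=> sK Kw _; apply: contrapT => nK; apply: Kw; rewrite -[w]Mc -ab ract_sumr.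
  apply: submod_sum => // p _; rewrite -ractA; apply: submod_ract => //.
  by apply: contrapT => Kp; apply: nK; exists p.
(* The right-hand side involves neither [K] nor [w]: any two such generators have the same
   annihilator, so the simple modules are isomorphic. *)
have ann (K : set M) w x : simple_at K w -> ract w (iota 1) = w ->
    K (ract w x) <-> forall r, rad_set (pi (x * r)).
  move=> sw we; have [sK _ _] := sw.
  have E r : ract w (iota (pi (x * r))) = ract w (x * r * iota 1).
    by rewrite -ipi -mulrA -ractA we.
  split=> [Kx r|radx].
    apply/(corner_annihilator iB iM ipi (locL i) sw we).
    by rewrite E -mulrA -ractA; apply: submod_ract.
  rewrite -[ract w x]Mc -ab ract_sumr; apply: submod_sum => // p _.
  rewrite -ractA; apply: submod_ract => //.
  rewrite ractA -ae mulrA -E.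
  exact/(corner_annihilator iB iM ipi (locL i) sw we).
have [K [w [sw wT]]] := simple_quotient killsN eloc e1 M0.
have [w' sw'] := simple_sub killsN eloc e1 M0.
have [p wp] := eqv _ _ sw; have [q w'q] := eqv _ _ sw'.
have we : ract (ract w (a p)) (iota 1) = ract w (a p) by rewrite ractA ae.
have w'e : ract (ract w' (a q)) (iota 1) = ract w' (a q) by rewrite ractA ae.
have sw1 := simple_at_ract sw wp; have sw'1 := simple_at_ract sw' w'q.
apply: (simple_of_top_bottom divM sw1 _ sw'1) => [v|x Kx].
  have [r Kr] := wT v; have [y Ky] := simple_at_absorb sw wp.
  exists (y * r); have [sK _ _] := sw; have [_ KD _] := sK.
  rewrite -(subrKA (ract w r)); apply: KD => //.
  rewrite ractA mulrA -[ract w (_ * r)]ractA -ractBl; apply: submod_ract => //.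
  by rewrite -opprB; apply: submodN.
by apply/(ann _ _ _ sw'1 w'e)/(ann _ _ _ sw1 we).
Qed.

(** * Quotient modules and extensions *)

Section QuotientModule.
Local Open Scope quotient_scope.
Variables (A : pzRingType) (M : lmodType A) (N : set M) (sN : is_submod N).

Definition quotmod_rel : rel M := fun u v => `[< N (u - v) >].

Fact quotmod_rel_refl : reflexive quotmod_rel.
Proof. by move=> u; apply/asboolP; rewrite subrr; case: sN. Qed.
Fact quotmod_rel_sym : symmetric quotmod_rel.
Proof.
by move=> u v; apply/asboolP/asboolP => /(submodN sN); rewrite opprB.
Qed.
Fact quotmod_rel_trans : transitive quotmod_rel.
Proof.
move=> v u w /asboolP uv /asboolP vw; apply/asboolP.
by rewrite -(subrKA v); have [_ ND _] := sN; apply: ND.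
Qed.

Canonical quotmod_equiv :=
  EquivRel quotmod_rel quotmod_rel_refl quotmod_rel_sym quotmod_rel_trans.

Definition quotient_mod : Type := {eq_quot quotmod_equiv}.
HB.instance Definition _ := Choice.on quotient_mod.

Definition quotm (u : M) : quotient_mod := \pi_{eq_quot quotmod_equiv} u.

Lemma quotmP (u v : M) : quotm u = quotm v <-> N (u - v).
Proof. by split=> [/eqmodP/asboolP//|Nuv]; apply/eqmodP/asboolP. Qed.

Let repr_ (q : quotient_mod) : M := repr (q : {eq_quot quotmod_equiv}).

Lemma quotm_ind (P : quotient_mod -> Prop) :
  (forall u, P (quotm u)) -> forall q, P q.
Proof. by move=> Pq q; rewrite -[q]reprK; apply: Pq. Qed.

Let reprE u : N (repr_ (quotm u) - u).
Proof. by apply/quotmP; apply: reprK. Qed.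

Definition quotm_add p q := quotm (repr_ p + repr_ q).
Definition quotm_opp p := quotm (- repr_ p).
Definition quotm_scale (a : A) p := quotm (a *: repr_ p).

Fact quotm_addE u v : quotm_add (quotm u) (quotm v) = quotm (u + v).
Proof.
by apply/quotmP; rewrite opprD addrACA; have [_ ND _] := sN; apply: ND.
Qed.
Fact quotm_oppE u : quotm_opp (quotm u) = quotm (- u).
Proof. by apply/quotmP; rewrite -opprD; apply: submodN. Qed.
Fact quotm_scaleE a u : quotm_scale a (quotm u) = quotm (a *: u).
Proof. by apply/quotmP; rewrite -scalerBr; have [_ _ NZ] := sN; apply: NZ. Qed.

Fact quotm_addA : associative quotm_add.
Proof.
elim/quotm_ind=> x; elim/quotm_ind=> y; elim/quotm_ind=> z.
by rewrite !quotm_addE addrA.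
Qed.
Fact quotm_addC : commutative quotm_add.
Proof.
by elim/quotm_ind=> x; elim/quotm_ind=> y; rewrite !quotm_addE addrC.
Qed.
Fact quotm_add0 : left_id (quotm 0) quotm_add.
Proof. by elim/quotm_ind=> x; rewrite quotm_addE add0r. Qed.
Fact quotm_addN : left_inverse (quotm 0) quotm_opp quotm_add.
Proof. by elim/quotm_ind=> x; rewrite quotm_oppE quotm_addE addNr. Qed.

HB.instance Definition _ := GRing.isZmodule.Build quotient_mod
  quotm_addA quotm_addC quotm_add0 quotm_addN.

Fact quotm_scaleA a b q : quotm_scale a (quotm_scale b q) = quotm_scale (a * b) q.
Proof. by elim/quotm_ind: q => u; rewrite !quotm_scaleE scalerA. Qed.
Fact quotm_scale1 : left_id 1 quotm_scale.
Proof. by elim/quotm_ind=> u; rewrite quotm_scaleE scale1r. Qed.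
Fact quotm_scaleDr : right_distributive quotm_scale +%R.
Proof.
move=> a; elim/quotm_ind=> u; elim/quotm_ind=> v.
by rewrite [quotm u + _]quotm_addE !quotm_scaleE [RHS]quotm_addE scalerDr.
Qed.
Fact quotm_scaleDl q : {morph quotm_scale^~ q : a b / a + b}.
Proof.
move=> a b; elim/quotm_ind: q => u.
by rewrite !quotm_scaleE [RHS]quotm_addE scalerDl.
Qed.

HB.instance Definition _ := GRing.Zmodule_isLmodule.Build A quotient_mod
  quotm_scaleA quotm_scale1 quotm_scaleDr quotm_scaleDl.

Lemma quotm_linear : linear quotm.
Proof. by move=> a u v; rewrite -quotm_addE -quotm_scaleE. Qed.

Lemma quotm_eq0 u : quotm u = 0 <-> N u.
Proof. by rewrite -{2}(subr0 u); apply: quotmP. Qed.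

End QuotientModule.

Section CyclicModules.
Variables (R : pzRingType).

Lemma right_ideal_submod (I : set R) : I 0 -> (forall x y, I x -> I y -> I (x + y)) ->
  (forall x a, I x -> I (x * a)) -> @is_submod R^c (regular_rmod R) I.
Proof. by move=> I0 ID IM; split=> // a x Ix; apply: IM. Qed.

Variables (K : set R) (sK : @is_submod R^c (regular_rmod R) K).

Lemma submod_regularM x a : K x -> K (x * a).
Proof. by have [_ _ KZ] := sK; apply: KZ. Qed.

Lemma submod_preimage_lmul (c : R) :
  @is_submod R^c (regular_rmod R) [set x : R | K (c * x)].
Proof.
have [K0 KD _] := sK; apply: right_ideal_submod => /= [|x y Kx Ky|x a Kx].
- by rewrite mulr0.
- by rewrite mulrDr; apply: KD.
- by rewrite mulrA; apply: submod_regularM.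
Qed.

(* The module c R / (c R meet K). *)
Definition cyclic_mod (c : R) : rmodType R := quotient_mod (submod_preimage_lmul c).

Definition cyc (c x : R) : cyclic_mod c := quotm (submod_preimage_lmul c) x.

Lemma cyc_linear c a x y : cyc c (x * a + y) = (a : R^c) *: cyc c x + cyc c y.
Proof. exact: quotm_linear. Qed.

Lemma ract_cyc c x a : ract (cyc c x) a = cyc c (x * a).
Proof. by rewrite -[x * a]addr0 cyc_linear [cyc c 0](_ : _ = 0) ?addr0. Qed.

Lemma cycP c x y : cyc c x = cyc c y <-> K (c * x - c * y).
Proof. by rewrite -mulrBr; apply: quotmP. Qed.

Lemma cyc_eq0 c x : cyc c x = 0 <-> K (c * x).
Proof. exact: quotm_eq0. Qed.

Lemma cyc_ind c (P : cyclic_mod c -> Prop) : (forall x, P (cyc c x)) -> forall v, P v.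
Proof. exact: (@quotm_ind _ _ _ (submod_preimage_lmul c) P). Qed.

Lemma cyc_surj c (v : cyclic_mod c) : exists x, v = cyc c x.
Proof. by elim/cyc_ind: v => x; exists x. Qed.

Lemma cyclic_simple c : ~ K c ->
  (forall x, K (c * x) \/ exists y, K (c * x * y - c)) -> simple_mod (cyclic_mod c).
Proof.
move=> nKc cP; apply: (@simple_at0 _ _ (cyc c 1)) => [|v]; last first.
  by elim/cyc_ind: v => x; exists x; rewrite ract_cyc mul1r.
split=> [||x]; first exact: submod0.
  by move=> /cyc_eq0; rewrite mulr1.
rewrite ract_cyc mul1r; have [Kcx|[y Ky]] := cP x.
  by left; apply/cyc_eq0.
right; exists y; rewrite ract_cyc mul1r; apply/eqP; rewrite subr_eq0; apply/eqP.
by apply/cycP; rewrite mulr1 mulrA.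
Qed.

End CyclicModules.

Section Arrows.
Variables (R : pzRingType) (J : ideal R) (m : nat) (e : 'I_m -> R).
Hypothesis eloc : forall i, local_idempotent J (e i).
Hypothesis e1 : \sum_i e i = 1.

(* If e_i x e_j were not in J^2, then e_i R / K, for a right ideal K of e_i J *)
(* containing e_i J^2 with e_i J / K simple and generated by the class of     *)
(* e_i x e_j, would be a nonsplit extension of e_i R / e_i J by a simple      *)
(* module isomorphic to e_j R / e_j J.                                        *)
Lemma no_arrow_ideal_pow2 : gabriel_totally_disconnected R ->
  forall i j x, (forall y, J (e i * y * e j)) -> J x -> ideal_pow J 2 (e i * x * e j).
Proof.
move=> td i j x eiej Jx; apply: contrapT => na; set a := e i * x * e j in na.
have [ii Jei eiP] := eloc i; have [jj Jej ejP] := eloc j.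
have pow2 u v : J u -> J v -> ideal_pow J 2 (u * v).
  by move=> Ju Jv; apply: (@ideal_powM _ _ 1 1); apply: ideal_pow1.
have pow2M u r : ideal_pow J 2 u -> ideal_pow J 2 (u * r).
  by move=> Ju; apply: (@ideal_powM _ _ 2 0) => //; apply: ideal_pow0.
have Ja : J a by apply: idealMr; apply: idealMl.
have sJ2 : @is_submod R^c (regular_rmod R) (ideal_pow J 2).
  apply: right_ideal_submod => //; last by move=> u v; apply: ideal_powD.
  by rewrite -[0](mulr0 (0 : R)); apply: pow2; apply: ideal0.
have [K1 [sK1 J2K1 nK1a K1max]] := maximal_avoiding sJ2 na.
have sJ : @is_submod R^c (regular_rmod R) J.
  apply: right_ideal_submod; [exact: ideal0| by move=> u v; apply: idealD|].
  by move=> u r; apply: idealMr.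
pose K : set R := K1 `&` J.
have sK : @is_submod R^c (regular_rmod R) K by apply: submodI.
have nKa : ~ K a by case.
have Kgen u : J u -> exists r, K (u - a * r).
  move=> Ju; have [|r Kr] := maximal_avoiding_top (M := regular_rmod R)
    eloc e1 sK1 nK1a K1max (v := u).
    by move=> y Jy; apply: J2K1; apply: pow2.
  by exists r; split=> //; apply: idealB => //; apply: idealMr.
have J2K u v : J u -> J v -> K (u * v).
  by move=> Ju Jv; split; [apply: J2K1; apply: pow2 | apply: idealMr].
have eia : e i * a = a by rewrite /a !mulrA ii.
have aej : a * e j = a by rewrite /a -!mulrA jj.
(* In order: [e_i R / e_i J], the image of [a R] modulo [K], and the image of [e_i R] modulo [K]. *)
pose S := cyclic_mod sJ (e i); pose T := cyclic_mod sK a; pose E := cyclic_mod sK (e i).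
have simS : simple_mod S.
  apply: cyclic_simple => // y; have [|[z yz]] := eiP y; first by left.
  by right; exists z; rewrite yz subrr; apply: ideal0.
have simT : simple_mod T.
  apply: cyclic_simple => // y; have [Jy|[z yz]] := ejP y.
    left; rewrite /a -mulrA; apply: J2K => //; exact: idealMl.
  right; exists z; rewrite -{1}aej -2!mulrA [e j * _]mulrA yz aej subrr.
  by have [] := sK.
(* The generator of [T] is fixed by [e j], whereas [e j] kills [S] because [e_i R e_j] is contained
   in [J]. *)
have nST : ~ isomorphic_mod S T.
  case=> f [g fK gK]; apply: nKa.
  have : cyc sK a (e j) = 0; last by move/cyc_eq0; rewrite aej.
  have : ract (cyc sK a (e j)) (e j) = cyc sK a (e j) by rewrite ract_cyc jj.
  rewrite -[in ract _ _](gK (cyc sK a (e j))).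
  have [y ->] := cyc_surj (g (cyc sK a (e j))) => <-.
  rewrite -[ract _ _]/((e j : R^c) *: f (cyc sJ (e i) y)) -linearZ.
  rewrite -[_ *: _]/(ract (cyc sJ (e i) y) (e j)) ract_cyc.
  suff /cyc_eq0 -> : J (e i * (y * e j)) by rewrite linear0.
  by rewrite mulrA.
have [q|v|b u u' v v'|f fP] := @linear_of_graph R^c T E
  (fun t q => exists2 r, t = cyc sK a r & q = cyc sK (e i) (a * r)).
- by have [r ->] := cyc_surj q; exists (cyc sK (e i) (a * r)), r.
- by case=> r /esym/cyc_eq0 Kr ->; apply/cyc_eq0; rewrite mulrA eia.
- case=> r -> -> [r' -> ->]; exists (r * b + r'); rewrite -cyc_linear //.
  by rewrite mulrDr mulrA.
have {}fP r : f (cyc sK a r) = cyc sK (e i) (a * r) by apply: fP; exists r.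
have [q|v|b u u' v v'|g gP] := @linear_of_graph R^c E S
  (fun q s => exists2 r, q = cyc sK (e i) r & s = cyc sJ (e i) r).
- by have [r ->] := cyc_surj q; exists (cyc sJ (e i) r), r.
- by case=> r /esym/cyc_eq0[_ Jr] ->; apply/cyc_eq0.
- by case=> r -> -> [r' -> ->]; exists (r * b + r'); rewrite -cyc_linear.
have {}gP r : g (cyc sK (e i) r) = cyc sJ (e i) r by apply: gP; exists r.
have f_inj : injective f.
  move=> u v; have [r ->] := cyc_surj u; have [s ->] := cyc_surj v; rewrite !fP.
  by move=> /cycP; rewrite 2!mulrA eia => Krs; apply/cycP.
have g_surj s : exists q, g q = s.
  by have [r ->] := cyc_surj s; exists (cyc sK (e i) r).
have fg_exact q : g q = 0 <-> exists t, f t = q.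
  have [r ->] := cyc_surj q; rewrite gP; split=> [/cyc_eq0/Kgen[s Ks]|[t]].
    by exists (cyc sK a s); rewrite fP; apply/esym/cycP; rewrite mulrA eia.
  have [s ->] := cyc_surj t; rewrite fP => /cycP[_]; rewrite mulrA eia => Js.
  apply/cyc_eq0; rewrite -[_ * r](subKr (a * s)).
  by apply: idealB => //; apply: idealMr.
apply: (td S T simS simT nST) => Ext0; apply: nKa.
(* The [T]-component of [h] at the class of [a] is the generator of [T]; it is also that of [h] at
   the class of [e i], times [a], so it has the form [a r a]. As [a r a] is in [J ^ 2], [a] would
   lie in [K]. *)
have [h [hf hg]] := Ext0 (Extension f_inj g_surj fg_exact).
have h1 := hf (cyc sK a 1); rewrite /= fP mulr1 in h1.
have [t [s hE]] : exists t s, h (cyc sK (e i) 1) = (t, s).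
  by case: (h _) => t s; exists t, s.
have : h (ract (cyc sK (e i) 1) a) = (a : R^c) *: (t, s) by rewrite linearZ hE.
rewrite ract_cyc mul1r h1 => -[] /esym.
have [r ->] := cyc_surj t; rewrite -[_ *: _]/(ract (cyc sK a r) a) ract_cyc => ra _.
have /cycP := ra; rewrite mulr1 => Kra.
rewrite -[a](subKr (a * (r * a))); apply: (submodB sK) => //.
by rewrite mulrA; apply: J2K => //; apply: idealMr.
Qed.

End Arrows.

(** * Blocks of idempotents *)

Lemma ideal_pow2_ind (R : pzRingType) (J : ideal R) (P : R -> Prop) :
    (forall x y, P x -> P y -> P (x + y)) ->
    (forall a x, P x -> P (a * x)) -> (forall a x, P x -> P (x * a)) ->
    (forall x y, J x -> J y -> P (x * y)) ->
  forall x, ideal_pow J 2 x -> P x.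
Proof.
move=> PD PMl PMr PJ x.
(* A derivation at exponent 2 passes through other exponents, so each gets a claim: none at 0,
   membership in [J] at 1, [P] from 2 on. *)
suff powP k y : ideal_pow J k y ->
    match k with 0 => True | 1 => J y | _ => P y end by move/powP.
elim=> {k y} [//|//|k l y z _ IHy _ IHz|[|[|k]] y z _ IHy _ IHz //].
- case: k IHy => [|[|k]] IHy; case: l IHz => [|[|l]] IHz //;
    rewrite ?addn0 ?addnS ?addSn ?add0n.
  + exact: idealMl.
  + exact: PMl.
  + exact: idealMr.
  + exact: PJ.
  + exact: PMl.
  + exact: PMr.
  + exact: PMr.
  + exact: PMr.
- exact: idealD.
- exact: PD.
Qed.

Lemma ideal_pow_zero (R : pzRingType) (J : ideal R) k : ideal_pow J k 0.
Proof.
elim: k => [|k IH]; first exact: ideal_pow0.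
by rewrite -[0](mulr0 0) -add1n; apply/ideal_powM => //; apply/ideal_pow1/ideal0.
Qed.

Section Links.
Variables (R : pzRingType) (J : ideal R) (n m : nat) (e : 'I_m -> R).
Hypothesis kills1 : kills J n 1.
Hypothesis eloc : forall i, local_idempotent J (e i).
Hypothesis e1 : \sum_i e i = 1.

(** Left multiplications by [a] and [b] are inverse isomorphisms between [e j R] and [e i R]; the
    equations give [a * e j = a] and [e j * b = b]. *)
Definition linked (i j : 'I_m) : Prop := exists a b,
  [/\ e i * a = a, b * e i = b, a * b = e i & b * a = e j].

(** An [a = e_i x e_j] outside [J] has a [b] with [a * b = e i]. Then [b * a] is an idempotent
    outside [J] in the corner of [e j], and locality makes it [e j]. *)
Lemma linkedP i j : (forall y, J (e i * y * e j)) \/ linked i j.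
Proof.
have [|] := pselect (forall y, J (e i * y * e j)); first by left.
move=> /existsNP[x Jx]; right.
have [ii Jei /(_ (x * e j))] := eloc i; rewrite mulrA => -[//|[y xy]].
have [jj Jej ejP] := eloc j.
pose a := e i * x * e j; pose b := e j * y * e i.
have ab : a * b = e i by rewrite /a /b -!mulrA [e j * (e j * _)]mulrA jj !mulrA xy ii.
have ae : a * e j = a by rewrite /a -mulrA jj.
have eb : e j * b = b by rewrite /b !mulrA jj.
have be : b * e i = b by rewrite /b -!mulrA ii.
exists a, b; split=> //; first by rewrite /a !mulrA ii.
have bb : b * a * (b * a) = b * a by rewrite mulrA -[b * a * b]mulrA ab be.
have := ejP (b * a); rewrite mulrA eb => -[|[z ez]].
  move=> Jba; case: Jei; rewrite -ii -{1}ab -ab mulrA -[a * b * a]mulrA.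
  by apply: idealMr; apply: idealMl.
by rewrite -ae mulrA -{1}ez mulrA bb ez.
Qed.

Lemma linked_refl i : linked i i.
Proof. by have [ii _ _] := eloc i; exists (e i), (e i). Qed.

Lemma linked_sym i j : linked i j -> linked j i.
Proof.
move=> [a [b [ea be ab ba]]]; exists b, a; split=> //.
  by rewrite -ba -mulrA ab.
by rewrite -ba mulrA ab.
Qed.

Lemma linked_trans j i k : linked i j -> linked j k -> linked i k.
Proof.
move=> [a [b [ea be ab ba]]] [c [d [ec de cd dc]]].
exists (a * c), (d * b); split.
- by rewrite mulrA ea.
- by rewrite -mulrA be.
- by rewrite mulrA -[a * c * d]mulrA cd -ba mulrA ab ea.
- by rewrite mulrA -[d * b * a]mulrA ba de.
Qed.

Lemma linked_corner0 : gabriel_totally_disconnected R ->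
  forall i j x, ~ linked i j -> e i * x * e j = 0.
Proof.
move=> td.
have nlJ i j y : ~ linked i j -> J (e i * y * e j).
  by move=> nl; have [|//] := linkedP i j.
suff powP k i j x : ~ linked i j -> J x -> ideal_pow J k.+1 (e i * x * e j).
  move=> i j x nl; have [ii _ _] := eloc i; have [jj _ _] := eloc j.
  have -> : e i * x * e j = e i * (e i * x * e j) * e j.
    by rewrite !mulrA ii -!mulrA jj.
  apply: (ideal_pow_eq0 kills1).
  case: n => [|k]; first exact: ideal_pow0.
  by apply: powP => //; apply: nlJ.
elim: k i j x => [|k IH] i j x nl Jx.
  by apply: ideal_pow1; apply: idealMr; apply: idealMl.
(* The outer factors [r] and [s] make the claim stable under multiplication, as the induction on
   [J ^ 2] requires. *)
suff powS y : ideal_pow J 2 y -> forall r s i j, ~ linked i j ->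
    ideal_pow J k.+2 (e i * (r * y * s) * e j).
  have [ii _ _] := eloc i; have [jj _ _] := eloc j.
  have -> : e i * x * e j = e i * (1 * (e i * x * e j) * 1) * e j.
    by rewrite mul1r mulr1 !mulrA ii -!mulrA jj.
  apply: powS => //; apply: (no_arrow_ideal_pow2 eloc e1 td) => // z.
  exact: nlJ.
move: y; apply: ideal_pow2_ind.
- move=> y z Py Pz r s i' j' nl'; rewrite mulrDr mulrDl mulrDr mulrDl.
  by apply: ideal_powD; [apply: Py | apply: Pz].
- by move=> b y Py r s i' j' nl'; rewrite [r * _]mulrA; apply: Py.
- move=> b y Py r s i' j' nl'.
  have -> : r * (y * b) * s = r * y * (b * s) by rewrite !mulrA.
  exact: Py.
move=> u v Ju Jv r s i' j' nl'.
have -> : e i' * (r * (u * v) * s) * e j' =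
    \sum_l (e i' * (r * u) * e l) * (e l * (v * s) * e j').
  transitivity (e i' * (r * u) * (\sum_l e l) * (v * s) * e j').
    by rewrite e1 mulr1 !mulrA.
  rewrite mulr_sumr !mulr_suml; apply: eq_bigr => l _.
  by have [ll _ _] := eloc l; rewrite -[in LHS]ll !mulrA.
apply: (big_ind (ideal_pow J k.+2)) => [||l _].
- exact: ideal_pow_zero.
- by move=> y z; apply: ideal_powD.
have Jru : J (r * u) by apply: idealMl.
have Jvs : J (v * s) by apply: idealMr.
(* One of the two factors joins unlinked indices and falls under [IH]; the other contributes one
   more factor from [J]. *)
have [il|nil] := pselect (linked i' l).
  have nlj : ~ linked l j' by move=> lj; apply: nl'; apply: linked_trans lj.
  rewrite -[k.+2]add1n; apply: ideal_powM; last exact: IH.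
  by apply: ideal_pow1; apply: idealMr; apply: idealMl.
rewrite -[k.+2]addn1; apply: ideal_powM; first exact: IH.
by apply: ideal_pow1; apply: idealMr; apply: idealMl.
Qed.
End Links.

(** * Corner rings and matrix units *)

Section Corner.
Variables (R : pzRingType) (e : R) (ee : e * e = e).

(** The proof of idempotency is an argument of the type, so that the ring structure with unit [e]
    can be attached to it. *)
Definition corner of e * e = e : Type := {x : R | e * x * e == x}.
Local Notation L := (corner ee).
HB.instance Definition _ := Choice.on L.

Definition corner_val (x : L) : R := val x.

Lemma corner_val_inj : injective corner_val.
Proof. exact: val_inj. Qed.

Fact corner_proj_subproof x : e * (e * x * e) * e == e * x * e.
Proof. by apply/eqP; rewrite !mulrA ee -mulrA ee. Qed.

Definition corner_proj (x : R) : L :=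
  exist (fun x => e * x * e == x) _ (corner_proj_subproof x).

Lemma corner_projE x : corner_val (corner_proj x) = e * x * e.
Proof. by []. Qed.

Lemma corner_l (x : L) : e * corner_val x = corner_val x.
Proof.
have E : e * corner_val x * e = corner_val x := eqP (valP x).
by rewrite -E !mulrA ee.
Qed.

Lemma corner_r (x : L) : corner_val x * e = corner_val x.
Proof.
have E : e * corner_val x * e = corner_val x := eqP (valP x).
by rewrite -E -!mulrA ee.
Qed.

Definition corner_add (x y : L) : L := corner_proj (corner_val x + corner_val y).
Definition corner_opp (x : L) : L := corner_proj (- corner_val x).
Definition corner_mul (x y : L) : L := corner_proj (corner_val x * corner_val y).

Fact corner_addE x y : corner_val (corner_add x y) = corner_val x + corner_val y.
Proof. by rewrite corner_projE mulrDr mulrDl !corner_l !corner_r. Qed.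
Fact corner_oppE x : corner_val (corner_opp x) = - corner_val x.
Proof. by rewrite corner_projE mulrN mulNr corner_l corner_r. Qed.
Fact corner_mulE x y : corner_val (corner_mul x y) = corner_val x * corner_val y.
Proof. by rewrite corner_projE mulrA corner_l -mulrA corner_r. Qed.
Fact corner_0E : corner_val (corner_proj 0) = 0.
Proof. by rewrite corner_projE mulr0 mul0r. Qed.
Fact corner_1E : corner_val (corner_proj 1) = e.
Proof. by rewrite corner_projE mulr1 ee. Qed.

Fact corner_addA : associative corner_add.
Proof. by move=> x y z; apply: corner_val_inj; rewrite !corner_addE addrA. Qed.
Fact corner_addC : commutative corner_add.
Proof. by move=> x y; apply: corner_val_inj; rewrite !corner_addE addrC. Qed.
Fact corner_add0 : left_id (corner_proj 0) corner_add.
Proof. by move=> x; apply: corner_val_inj; rewrite corner_addE corner_0E add0r. Qed.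
Fact corner_addN : left_inverse (corner_proj 0) corner_opp corner_add.
Proof.
by move=> x; apply: corner_val_inj; rewrite corner_addE corner_oppE corner_0E addNr.
Qed.

HB.instance Definition _ := GRing.isZmodule.Build L
  corner_addA corner_addC corner_add0 corner_addN.

Fact corner_mulA : associative corner_mul.
Proof. by move=> x y z; apply: corner_val_inj; rewrite !corner_mulE mulrA. Qed.
Fact corner_mul1l : left_id (corner_proj 1) corner_mul.
Proof. by move=> x; apply: corner_val_inj; rewrite corner_mulE corner_1E corner_l. Qed.
Fact corner_mul1r : right_id (corner_proj 1) corner_mul.
Proof. by move=> x; apply: corner_val_inj; rewrite corner_mulE corner_1E corner_r. Qed.
Fact corner_mulDl : left_distributive corner_mul corner_add.
Proof.
by move=> x y z; apply: corner_val_inj; rewrite !(corner_mulE, corner_addE) mulrDl.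
Qed.
Fact corner_mulDr : right_distributive corner_mul corner_add.
Proof.
by move=> x y z; apply: corner_val_inj; rewrite !(corner_mulE, corner_addE) mulrDr.
Qed.

HB.instance Definition _ := GRing.Zmodule_isPzRing.Build L
  corner_mulA corner_mul1l corner_mul1r corner_mulDl corner_mulDr.

Lemma corner_valD (x y : L) : corner_val (x + y) = corner_val x + corner_val y.
Proof. exact: corner_addE. Qed.
Lemma corner_valN (x : L) : corner_val (- x) = - corner_val x.
Proof. exact: corner_oppE. Qed.
Lemma corner_valM (x y : L) : corner_val (x * y) = corner_val x * corner_val y.
Proof. exact: corner_mulE. Qed.
Lemma corner_val0 : corner_val (0 : L) = 0.
Proof. exact: corner_0E. Qed.
Lemma corner_val1 : corner_val (1 : L) = e.
Proof. exact: corner_1E. Qed.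
Lemma corner_val_sum (I : Type) (r : seq I) (P : pred I) (F : I -> L) :
  corner_val (\sum_(i <- r | P i) F i) = \sum_(i <- r | P i) corner_val (F i).
Proof. exact: (big_morph _ corner_valD corner_val0). Qed.

Variable J : ideal R.
Hypothesis eloc : local_idempotent J e.

(** Locality of [e] gives a right inverse; it is again outside [J], so it has a right inverse too,
    which must be [x]. *)
Lemma corner_unit (x : L) : ~ J (corner_val x) -> exists y, y * x = 1 /\ x * y = 1.
Proof.
have [_ nJ eP] := eloc.
have rinv (y : L) : ~ J (corner_val y) -> exists z, y * z = 1.
  move=> Jy; have := eP (corner_val y); rewrite corner_l => -[/Jy//|[z yz]].
  exists (corner_proj z); apply: corner_val_inj.
  by rewrite corner_valM corner_val1 corner_projE !mulrA corner_r yz ee.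
move=> /[dup] Jx /rinv[y xy]; exists y; split=> //.
have [z yz] : exists z, y * z = 1.
  apply: rinv => Jy; apply: nJ; rewrite -corner_val1 -xy corner_valM.
  exact: idealMl.
by have -> : x = z by rewrite -[LHS]mulr1 -yz mulrA xy mul1r.
Qed.

Lemma corner_submod_top (N : set (regular_rmod L)) (x : L) :
  is_submod N -> N x -> ~ J (corner_val x) -> N = setT.
Proof.
move=> [_ _ NZ] Nx /corner_unit[y [_ xy]]; apply/seteqP; split=> // z _.
have := NZ (y * (z : L)) x Nx.
by rewrite -[_ *: _]/((x : L) * (y * (z : L))) mulrA xy mul1r.
Qed.

Lemma corner_local : local_ring L.
Proof.
have [_ nJ _] := eloc.
(* All elements outside [N0] are units, so [N0] is the only maximal right ideal, hence the
   radical. *)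
pose N0 : set (regular_rmod L) := [set x : L | J (corner_val x)].
have sN0 : is_submod N0.
  split=> [|x y Jx Jy|a x Jx]; rewrite /N0 /=.
  - by rewrite corner_val0; apply: ideal0.
  - by rewrite corner_valD; apply: idealD.
  - by rewrite -[corner_val _]/(corner_val ((x : L) * a)) corner_valM; apply: idealMr.
have N0T : N0 <> setT.
  by move=> N0T; apply: nJ; rewrite -corner_val1 -[J _]/(N0 1) N0T.
have mN0 : maximal_submod N0.
  split=> // K sK N0K; have [KN0|] := pselect (K `<=` N0).
    by left; apply/seteqP.
  by move=> /existsNP[x /not_implyP[Kx Jx]]; right; apply: corner_submod_top sK Kx Jx.
have radE (x : L) : rad_set x <-> J (corner_val x).
  split=> [rx|Jx N [sN NT Nmax]]; first exact: (rx N0 mN0).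
  have NN0 : N `<=` N0.
    move=> y Ny; apply: contrapT => Jy; apply: NT.
    exact: corner_submod_top sN Ny Jy.
  by have [<-|//] := Nmax N0 sN0 NN0.
split=> [/quoP|]; first by rewrite subr0 => /radE; rewrite corner_val1.
elim/quo_ind=> x x0; have [|y [yx xy]] := @corner_unit x.
  by move=> /radE Jx; apply: x0; apply/quoP; rewrite subr0.
exists (quo _ y); split.
  by rewrite -[LHS]/(quo_mul _ _) quo_mulE yx.
by rewrite -[LHS]/(quo_mul _ _) quo_mulE xy.
Qed.

End Corner.

(* In the c-th block, b c p * x * a c q is the matrix with the single entry x *)
(* in u c R u c, at position (p, q).                                          *)
Lemma matrix_units_product (R : pzRingType) (k : nat) (n : 'I_k -> nat)
    (u : 'I_k -> R) (uu : forall c, u c * u c = u c)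
    (a b : forall c, 'I_(n c) -> R) :
    (forall c p, u c * a c p = a c p) -> (forall c p, b c p * u c = b c p) ->
    (forall c p q, a c p * b c q = if p == q then u c else 0) ->
    \sum_c \sum_p b c p * a c p = 1 ->
    (forall c c' p q x, c != c' -> a c p * x * b c' q = 0) ->
  isomorphic_ring R (prod_ring (fun c => 'M[corner (uu c)]_(n c) : pzRingType)).
Proof.
move=> ua bu ab ba1 acc'.
pose B c : pzRingType := 'M[corner (uu c)]_(n c).
pose f (r : R) : prod_ring B :=
  [ffun c => (\matrix_(p, q) corner_proj (uu c) (a c p * r * b c q)) : B c].
have fE r c p q : corner_val ((f r c : 'M_(n c)) p q) = a c p * r * b c q.
  by rewrite ffunE mxE corner_projE !mulrA ua -!mulrA bu.
have eqB (X Y : prod_ring B) : (forall c p q,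
    corner_val ((X c : 'M_(n c)) p q) = corner_val ((Y c : 'M_(n c)) p q)) -> X = Y.
  by move=> XY; apply/ffunP => c; apply/matrixP => p q; apply: corner_val_inj.
(* Inserted between two factors, this expansion of 1 turns the product of [R] into the matrix
   product. *)
have sandwich x : x = \sum_c \sum_p b c p * a c p * x.
  by rewrite -[LHS]mul1r -ba1 mulr_suml; apply: eq_bigr => c _; rewrite mulr_suml.
have fB : zmod_morphism f.
  move=> r s; apply: eqB => c p q.
  rewrite prod_subE !mxE corner_valD corner_valN !fE.
  by rewrite mulrBr mulrBl.
have fM : monoid_morphism f.
  split=> [|r s]; apply: eqB => c p q.
    rewrite fE mulr1 ab ffunE !mxE; case: eqP => _; rewrite /= ?mulr1n ?mulr0n.
      by rewrite corner_val1.
    by rewrite corner_val0.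
  rewrite fE prod_mulE mxE corner_val_sum [s in LHS]sandwich.
  rewrite mulrA mulr_sumr mulr_suml (bigD1 c) //= [X in _ + X]big1 ?addr0.
    rewrite mulr_sumr mulr_suml; apply: eq_bigr => t _.
    by rewrite corner_valM !fE !mulrA.
  move=> c' cc'; rewrite mulr_sumr mulr_suml big1 // => t _.
  by rewrite !mulrA acc' ?mul0r // eq_sym.
pose F : {rmorphism R -> prod_ring B} := HB.pack f
  (GRing.isZmodMorphism.Build _ _ f fB) (GRing.isMonoidMorphism.Build _ _ f fM).
exists F; apply: inj_surj_bijective => [r s frs|X].
  have {}frs c p q : a c p * r * b c q = a c p * s * b c q by rewrite -!fE [f r]frs.
  have frs' c p x : a c p * r * x = a c p * s * x.
    rewrite [x]sandwich !mulr_sumr; apply: eq_bigr => c' _.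
    rewrite !mulr_sumr; have [<-|cc'] := eqVneq c c'; apply: eq_bigr => q _.
      by rewrite !mulrA frs.
    by rewrite !mulrA !acc'.
  rewrite [r]sandwich [s]sandwich; apply: eq_bigr => c _; apply: eq_bigr => p _.
  by have := frs' c p 1; rewrite !mulr1 -!mulrA => ->.
pose x c p q : R := corner_val ((X c : 'M_(n c)) p q).
(* Each entry of [X] is carried from its corner to position [(p, q)]. *)
exists (\sum_c \sum_p \sum_q b c p * x c p q * a c q).
apply: eqB => c p q; rewrite -[F _]/(f _) fE -/(x c p q).
rewrite mulr_sumr mulr_suml (bigD1 c) //= [X in _ + X]big1 ?addr0; last first.
  move=> c' cc'; rewrite mulr_sumr mulr_suml big1 // => p' _.
  rewrite mulr_sumr mulr_suml big1 // => q' _.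
  have := acc' c c' p p' 1; rewrite mulr1 !mulrA => ->; last by rewrite eq_sym.
  by rewrite !mul0r.
rewrite mulr_sumr mulr_suml (bigD1 p) //= [X in _ + X]big1 ?addr0; last first.
  move=> p' pp'; rewrite mulr_sumr mulr_suml big1 // => q' _.
  by rewrite !mulrA ab eq_sym (negPf pp') !mul0r.
rewrite mulr_sumr mulr_suml (bigD1 q) //= [X in _ + X]big1 ?addr0; last first.
  by move=> q' qq'; rewrite -!mulrA ab (negPf qq') !mulr0.
by rewrite !mulrA ab eqxx -!mulrA ab eqxx corner_r corner_l.
Qed.

(** * Linkage classes of idempotents, and the equivalence *)

Lemma totally_disconnected_matrix_rings (R : pzRingType) : semiprimary R ->
  gabriel_totally_disconnected R -> product_of_matrix_rings_over_local_rings R.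
Proof.
move=> [nilR ssR] td; have [N killsN] := nilpotent_kills nilR.
have [m [e [eloc eorth e1]]] := ex_local_idempotents killsN ssR.
pose lk i j := `[< linked e i j >].
(* The chosen point depends on the class alone, so linked indices get the same representative. *)
pose rep i := choose (lk i) i.
have lk_rep i : linked e i (rep i).
  by apply/asboolP/(chooseP (P := lk i)); apply/asboolP; apply: linked_refl eloc _.
have rep_eq i j : linked e i j -> rep i = rep j.
  move=> ij; have lij : lk i =1 lk j.
    move=> l; apply/asboolP/asboolP; apply: linked_trans => //.
    exact: linked_sym.
  rewrite /rep (eq_choose lij); apply: choose_id; apply/asboolP.
    exact: linked_sym.
  exact: linked_refl eloc _.
(* These identify each [e i R] with the module of its representative, and serve as matrix units over
   the corner at that representative. *)
have /choice[A /choice[B AB]] : forall i, exists a b,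
    [/\ e (rep i) * a = a, b * e (rep i) = b, a * b = e (rep i) & b * a = e i].
  by move=> i; apply: linked_sym.
have Ae i : A i * e i = A i by have [eA _ AB1 BA] := AB i; rewrite -BA mulrA AB1.
have eB i : e i * B i = B i by have [_ Be AB1 BA] := AB i; rewrite -BA -mulrA AB1.
pose C := [set i | rep i == i]%SET.
pose r (c : 'I_#|C|) := enum_val c.
have rep_r c : rep (r c) = r c by have := enum_valP c; rewrite inE => /eqP.
pose cls c := [set i | rep i == r c]%SET.
pose pt c (p : 'I_#|cls c|) := enum_val p.
have rep_pt c (p : 'I_#|cls c|) : rep (pt c p) = r c.
  by have := enum_valP p; rewrite inE => /eqP.
have uu c : e (r c) * e (r c) = e (r c) by have [] := eloc (r c).
exists #|C|, (fun c => #|cls c|), (fun c => corner (uu c)); split.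
- by move=> c; rewrite card_gt0; apply/set0Pn; exists (r c); rewrite inE rep_r.
- by move=> c; apply: corner_local (eloc (r c)).
apply: (@matrix_units_product R _ (fun c => #|cls c|) _ uu
  (fun c p => A (pt c p)) (fun c p => B (pt c p))).
- by move=> c p; rewrite -(rep_pt c p); have [] := AB (pt c p).
- by move=> c p; rewrite -(rep_pt c p); have [] := AB (pt c p).
- move=> c p q; case: eqP => [<-|/eqP pq].
    by rewrite -(rep_pt c p); have [] := AB (pt c p).
  rewrite -Ae -eB mulrA -[_ * e _ * e _]mulrA eorth ?mulr0 ?mul0r //.
  by rewrite (inj_eq enum_val_inj).
- rewrite -e1 [RHS](partition_big rep (mem C)) /=; last first.
    by move=> i _; rewrite inE -(rep_eq _ _ (lk_rep i)).
  rewrite [RHS]big_enum_val -[RHS]/(\sum_c \sum_(i | rep i == r c) e i).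
  apply: eq_bigr => c _.
  transitivity (\sum_(i in cls c) e i); last by apply: eq_bigl => i; rewrite inE.
  rewrite [RHS]big_enum_val -[RHS]/(\sum_p e (pt c p)).
  by apply: eq_bigr => p _; have [] := AB (pt c p).
move=> c c' p q x cc'.
rewrite -Ae -eB !mulrA -[_ * e _ * x]mulrA -[_ * (e _ * x) * e _]mulrA.
rewrite (linked_corner0 killsN eloc e1 td) ?mulr0 ?mul0r // => /rep_eq.
by rewrite !rep_pt => /enum_val_inj/eqP; rewrite (negPf cc').
Qed.

Theorem theorem1p6 (R : pzRingType) (hR : semiprimary R) :
  [<-> has_CSL (fun M : rmodType R => finite_length M);
       gabriel_totally_disconnected R;
       product_of_matrix_rings_over_local_rings R;
       has_CSL (fun M : rmodType R => True) ].
Proof.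
tfae.
- exact: CSL_totally_disconnected.
- exact: totally_disconnected_matrix_rings.
- exact: matrix_rings_CSL.
- by move=> csl M _; apply: csl.
Qed.
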